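(* Let $R>0$ and let $k,\ell$ be nonzero integers. Consider smooth functions $\alpha:[0,\pi/2]\to[0,\pi]$ with $\alpha(0)=0$, $\alpha(\pi/2)=\pi$, and the reduced $\sigma_2$-energy functional $$\varepsilon_{\sigma_2}(\alpha)=\frac{2\pi^2}{R}\int_0^{\pi/2}\left(k^2\tan s+\ell^2\cot s\right)(\alpha'(s))^2\sin^2\alpha(s)\,\mathrm ds .$$ Then the equation $$\alpha'\sin\alpha\left\{\left[\alpha''\sin\alpha+(\alpha')^2\cos\alpha\right]\left(\frac{k^2}{\cos^2 s}+\frac{\ell^2}{\sin^2 s}\right)+\alpha'\sin\alpha\left(\frac{k^2}{\sin s\cos^3 s}-\frac{\ell^2}{\cos s\sin^3 s}\right)\right\}=0,\qquad s\in(0,\pi/2),$$ is the Euler-Lagrange equation of $\varepsilon_{\sigma_2}$, i.e. $\alpha$ satisfies it if and only if $\alpha$ is a critical point of $\varepsilon_{\sigma_2}$ with respect to fixed-endpoint variations. Moreover, the solutions $$\alpha(s)=\begin{cases}\arccos\left(1-2\,\dfrac{\ln\left(\frac{k^2}{\ell^2}\sin^2 s+\cos^2 s\right)}{\ln\frac{k^2}{\ell^2}}\right), & \text{if } |k|>|\ell|,\\[3mm] 2s, & \text{if } |k|=|\ell|,\end{cases}$$ are stable critical points of the functional $\varepsilon_{\sigma_2}$.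
   Context: A fixed-endpoint variation of $\alpha$ is a smooth family $\{\alpha_t\}_{t\in(-\epsilon,\epsilon)}$ of functions on $[0,\pi/2]$ (smooth jointly in $(t,s)$) with $\alpha_0=\alpha$, $\alpha_t(0)=0$ and $\alpha_t(\pi/2)=\pi$ for all $t$. The function $\alpha$ is a critical point of $\varepsilon_{\sigma_2}$ if $\frac{\mathrm d}{\mathrm dt}\big|_{t=0}\varepsilon_{\sigma_2}(\alpha_t)=0$ for all such variations. A critical point is stable if $\frac{\mathrm d^2}{\mathrm dt^2}\big|_{t=0}\varepsilon_{\sigma_2}(\alpha_t)\ge 0$ for all such variations. Origin of the functional: $\varepsilon_{\sigma_2}(\alpha)$ is the $\sigma_2$-energy $\frac12\int|\wedge^2\mathrm d\varphi|^2\nu_g$ of the map $\varphi=\varphi^\alpha_{k,\ell}:\mathbb S^3_R\to\mathbb S^2$ from the round 3-sphere of radius $R$ to the unit 2-sphere given by $\varphi^\alpha_{k,\ell}(R\cos s\, e^{\mathrm i x_1},R\sin s\, e^{\mathrm i x_2})=(\cos\alpha(s),\ \sin\alpha(s)\,e^{\mathrm i(kx_1+\ell x_2)})\in\mathbb R\times\mathbb C$. *)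

(* Defs.v *)
From Stdlib Require Export Reals ZArith.
From Coquelicot Require Export Coquelicot.
Open Scope R_scope.

(* Functions on [0, PI/2] are total functions R -> R of which only the
   restriction to [0, PI/2] is relevant.  Such a restriction is smooth if it
   extends to a C^infinity function on an open neighbourhood of [0, PI/2]. *)
Definition smooth_on_quarter (alpha : R -> R) : Prop :=
  exists F : R -> R,
    (forall s, 0 <= s <= PI / 2 ->
       locally s (fun x => forall n, ex_derive_n F n x)) /\
    (forall s, 0 <= s <= PI / 2 -> F s = alpha s).

(* Likewise, smoothness jointly in (t, s) on (-eps, eps) x [0, PI/2]:
   extension to a C^infinity function of two variables on an open
   neighbourhood of that set. *)
Definition smooth_family (eps : R) (A : R -> R -> R) : Prop :=
  exists F : R -> R -> R,
    (forall t s, - eps < t < eps -> 0 <= s <= PI / 2 ->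
       locally_2d (fun u v => forall n, ex_diff_n F n u v) t s) /\
    (forall t s, - eps < t < eps -> 0 <= s <= PI / 2 -> F t s = A t s).

Definition admissible (alpha : R -> R) : Prop :=
  smooth_on_quarter alpha /\
  (forall s, 0 <= s <= PI / 2 -> 0 <= alpha s <= PI) /\
  alpha 0 = 0 /\
  alpha (PI / 2) = PI.

(* The integrand is taken on the open interval (0, PI/2), where tan, cot and
   [Derive alpha] are the expected ones; [RInt] does not depend on the values
   at the two endpoints, and for alpha smooth with sin alpha = 0 at both
   endpoints the integrand extends continuously by 0 there. *)
Definition energy (r : R) (k l : Z) (alpha : R -> R) : R :=
  2 * PI ^ 2 / r *
  RInt (fun s => (IZR k ^ 2 * tan s + IZR l ^ 2 * (cos s / sin s)) *
                 Derive alpha s ^ 2 * sin (alpha s) ^ 2) 0 (PI / 2).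

(* The members of a variation are real-valued; they need not take values in
   [0, PI]. *)
Definition variation (alpha : R -> R) (eps : R) (A : R -> R -> R) : Prop :=
  0 < eps /\
  smooth_family eps A /\
  (forall s, 0 <= s <= PI / 2 -> A 0 s = alpha s) /\
  (forall t, - eps < t < eps -> A t 0 = 0 /\ A t (PI / 2) = PI).

Definition critical (r : R) (k l : Z) (alpha : R -> R) : Prop :=
  forall (eps : R) (A : R -> R -> R), variation alpha eps A ->
    is_derive (fun t => energy r k l (A t)) 0 0.

(* Differentiability near t = 0 is required so that the total function
   [Derive] is a genuine derivative there and [is_derive_n _ 2 0 d] says that
   d is the second derivative. *)
Definition stable_critical (r : R) (k l : Z) (alpha : R -> R) : Prop :=
  critical r k l alpha /\
  forall (eps : R) (A : R -> R -> R), variation alpha eps A ->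
    locally 0 (fun t => ex_derive (fun t => energy r k l (A t)) t) /\
    exists d : R,
      is_derive_n (fun t => energy r k l (A t)) 2 0 d /\ 0 <= d.

Definition EL_equation (k l : Z) (alpha : R -> R) : Prop :=
  forall s, 0 < s < PI / 2 ->
    Derive alpha s * sin (alpha s) *
    ((Derive_n alpha 2 s * sin (alpha s) + Derive alpha s ^ 2 * cos (alpha s)) *
       (IZR k ^ 2 / cos s ^ 2 + IZR l ^ 2 / sin s ^ 2) +
     Derive alpha s * sin (alpha s) *
       (IZR k ^ 2 / (sin s * cos s ^ 3) - IZR l ^ 2 / (cos s * sin s ^ 3)))
    = 0.

Definition alpha_log (k l : Z) (s : R) : R :=
  acos (1 - 2 * (ln (IZR k ^ 2 / IZR l ^ 2 * sin s ^ 2 + cos s ^ 2) /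
                 ln (IZR k ^ 2 / IZR l ^ 2))).

(* Main.v *)
Require Import Defs.
From Stdlib Require Import Lra Lia Psatz Arith.

(* With f = cos alpha the energy is the quadratic form of f with weight
   w = k^2 tan + l^2 cot, and the equation says that f' (w f')' = 0.  Where
   (w f')' is nonzero, f' would vanish nearby, and so would (w f')'; hence the
   equation is equivalent to the flux w f' being constant.

   If w f' = c, then for a variation f_t the integrals of w f' (f_t)' are
   c (f_t(pi/2) - f_t(0)) = -2 c, so their t-derivatives vanish: the first
   derivative of the energy at 0 is zero and the second is twice the form
   at the t-derivative of (f_t)', which is nonnegative.  Conversely, the
   variation alpha + t (w f')' sin alpha (sin cos)^4 gives, after integration
   by parts, the vanishing of the integral of ((w f')' sin^2 cos^2 sin alpha)^2.

   For |k| > |l| the given alpha satisfies sin^2 (alpha/2) = u and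
   cos^2 (alpha/2) = 1 - u with u = ln (q sin^2 + cos^2) / ln q.  Both are
   squares of smooth functions a = sin * .. and b = cos * .., because
   ln (1 + z) / z is smooth and positive, so that
   alpha = pi/2 + 2 atan ((a - b) / (a + b)) is smooth up to the endpoints. *)

(** * Functions with derivatives of all orders on an open set *)

Lemma is_derive_ext_open (O : R -> Prop) (f g : R -> R) (x l : R) :
  open O -> O x -> (forall y, O y -> f y = g y) ->
  is_derive f x l -> is_derive g x l.
Proof.
intros HO Ox Hfg Hf.
apply (is_derive_ext_loc f g); [|exact Hf].
apply (filter_imp O); [exact Hfg | exact (HO x Ox)].
Qed.

(* Quantifying over some derivative [f'] rather than using [Derive f] avoids
   all rewriting of derivatives under [Derive_n]. *)
Fixpoint Ck (O : R -> Prop) (n : nat) (f : R -> R) : Prop :=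
  match n with
  | 0%nat => True
  | S m => exists f', (forall x, O x -> is_derive f x (f' x)) /\ Ck O m f'
  end.

Definition Cinf (O : R -> Prop) (f : R -> R) : Prop := forall n, Ck O n f.

Lemma Ck_pred (O : R -> Prop) n f : Ck O (S n) f -> Ck O n f.
Proof.
revert f; induction n as [|n IH]; intros f H; [exact I|].
destruct H as [f' [H1 H2]]; exists f'; split; auto.
Qed.

Lemma Ck_subset (O O' : R -> Prop) n f :
  (forall x, O x -> O' x) -> Ck O' n f -> Ck O n f.
Proof.
intros HO; revert f; induction n as [|n IH]; intros f H; [exact I|].
destruct H as [f' [H1 H2]]; exists f'; split; auto.
Qed.

Lemma Ck_const (O : R -> Prop) n c : Ck O n (fun _ => c).
Proof.
revert c; induction n as [|n IH]; intros c; [exact I|].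
exists (fun _ => 0); split; [|apply IH].
intros x _; apply (is_derive_const c).
Qed.

Lemma Ck_id (O : R -> Prop) n : Ck O n (fun x => x).
Proof.
destruct n as [|n]; [exact I|].
exists (fun _ => 1); split; [|apply Ck_const].
intros x _; apply (is_derive_id x).
Qed.

Lemma Ck_plus (O : R -> Prop) n f g :
  Ck O n f -> Ck O n g -> Ck O n (fun x => f x + g x).
Proof.
revert f g; induction n as [|n IH]; intros f g Hf Hg; [exact I|].
destruct Hf as [f' [Hf1 Hf2]]; destruct Hg as [g' [Hg1 Hg2]].
exists (fun x => f' x + g' x); split; [|auto].
intros x Ox; apply (is_derive_plus f g); auto.
Qed.

Lemma Ck_mult (O : R -> Prop) n f g :
  Ck O n f -> Ck O n g -> Ck O n (fun x => f x * g x).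
Proof.
revert f g; induction n as [|n IH]; intros f g Hf Hg; [exact I|].
assert (Hf0 := Ck_pred _ _ _ Hf); assert (Hg0 := Ck_pred _ _ _ Hg).
destruct Hf as [f' [Hf1 Hf2]]; destruct Hg as [g' [Hg1 Hg2]].
exists (fun x => f' x * g x + f x * g' x); split.
- intros x Ox.
  apply (is_derive_mult f g x (f' x) (g' x)); auto.
  intros; apply Rmult_comm.
- apply Ck_plus; auto.
Qed.

Lemma Ck_opp (O : R -> Prop) n f : Ck O n f -> Ck O n (fun x => - f x).
Proof.
revert f; induction n as [|n IH]; intros f Hf; [exact I|].
destruct Hf as [f' [H1 H2]]; exists (fun x => - f' x); split; [|auto].
intros x Ox; apply (is_derive_opp f); auto.
Qed.

Lemma Ck_minus (O : R -> Prop) n f g :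
  Ck O n f -> Ck O n g -> Ck O n (fun x => f x - g x).
Proof. intros Hf Hg; apply Ck_plus; [|apply Ck_opp]; assumption. Qed.

Lemma Ck_inv (O : R -> Prop) n f :
  (forall x, O x -> f x <> 0) -> Ck O n f -> Ck O n (fun x => / f x).
Proof.
intros Hf0; induction n as [|n IH]; intros Hf; [exact I|].
specialize (IH (Ck_pred _ _ _ Hf)).
destruct Hf as [f' [H1 H2]].
exists (fun x => - f' x * (/ f x * / f x)); split.
- intros x Ox.
  replace (- f' x * (/ f x * / f x)) with (- f' x / f x ^ 2)
    by (field; auto).
  apply is_derive_inv; auto.
- apply Ck_mult; [apply Ck_opp; exact H2 | apply Ck_mult; exact IH].
Qed.

Lemma Ck_div (O : R -> Prop) n f g :
  (forall x, O x -> g x <> 0) ->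
  Ck O n f -> Ck O n g -> Ck O n (fun x => f x / g x).
Proof. intros Hg0 Hf Hg; apply Ck_mult; [|apply Ck_inv]; assumption. Qed.

Lemma Ck_comp (O O' : R -> Prop) n f g :
  (forall x, O x -> O' (f x)) -> Ck O n f -> Ck O' n g ->
  Ck O n (fun x => g (f x)).
Proof.
intros HO; revert g; induction n as [|n IH]; intros g Hf Hg; [exact I|].
assert (Hf0 := Ck_pred _ _ _ Hf).
destruct Hf as [f' [Hf1 Hf2]]; destruct Hg as [g' [Hg1 Hg2]].
exists (fun x => f' x * g' (f x)); split.
- intros x Ox; apply (is_derive_comp g f); auto.
- apply Ck_mult; auto.
Qed.

Lemma Ck_sin_cos (O : R -> Prop) n : Ck O n sin /\ Ck O n cos.
Proof.
induction n as [|n [IHs IHc]]; [split; exact I|]; split.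
- exists cos; split; [|exact IHc]; intros x _; apply is_derive_sin.
- exists (fun x => - sin x); split; [|apply Ck_opp; exact IHs].
  intros x _; apply is_derive_cos.
Qed.

Lemma Ck_sin (O : R -> Prop) n : Ck O n sin.
Proof. apply Ck_sin_cos. Qed.

Lemma Ck_cos (O : R -> Prop) n : Ck O n cos.
Proof. apply Ck_sin_cos. Qed.

Lemma Ck_atan (O : R -> Prop) n : Ck O n atan.
Proof.
destruct n as [|n]; [exact I|].
exists (fun x => / (1 + x * x)); split.
- intros x _; apply is_derive_atan.
- apply Ck_inv; [intros x _; nra|].
  apply Ck_plus; [apply Ck_const | apply Ck_mult; apply Ck_id].
Qed.

Lemma Ck_sqrt n : Ck (fun x => 0 < x) n sqrt.
Proof.
induction n as [|n IH]; [exact I|].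
exists (fun x => / (2 * sqrt x)); split.
- intros x Hx.
  auto_derive; [exact Hx|]; field; apply Rgt_not_eq, sqrt_lt_R0, Hx.
- apply Ck_inv.
  + intros x Hx; apply sqrt_lt_R0 in Hx; lra.
  + apply Ck_mult; [apply Ck_const | exact IH].
Qed.

Lemma Ck_ext (O : R -> Prop) n f g : open O ->
  (forall x, O x -> f x = g x) -> Ck O n f -> Ck O n g.
Proof.
intros HO Hfg Hf; destruct n as [|n]; [exact I|].
destruct Hf as [f' [H1 H2]]; exists f'; split; [|exact H2].
intros x Ox; apply (is_derive_ext_open O f); auto.
Qed.

Lemma Ck_Derive (O : R -> Prop) n f : open O -> Ck O (S n) f -> Ck O n (Derive f).
Proof.
intros HO [f' [H1 H2]]; apply (Ck_ext O n f'); auto.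
intros x Ox; symmetry; apply is_derive_unique; auto.
Qed.

Lemma Ck_Derive_n (O : R -> Prop) m n f : open O ->
  Ck O (m + n) f -> Ck O n (Derive_n f m).
Proof.
intros HO; revert n; induction m as [|m IH]; intros n Hf; [exact Hf|].
apply Ck_Derive; [exact HO|]; apply IH.
now replace (m + S n)%nat with (S m + n)%nat by lia.
Qed.

Lemma Cinf_ex_derive_n (O : R -> Prop) f : open O -> Cinf O f ->
  forall n x, O x -> ex_derive_n f n x.
Proof.
intros HO Hf [|n] x Ox; [exact I|].
destruct (Ck_Derive_n O n 1 f HO (Hf _)) as [f' [H1 _]].
exists (f' x); auto.
Qed.

Lemma ex_derive_n_Cinf (O : R -> Prop) f :
  (forall x, O x -> forall n, ex_derive_n f n x) -> Cinf O f.
Proof.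
intros Hf n.
(* The induction on [n] has to treat all iterated derivatives at once, because the step passes from
   [Derive_n f m] to [Derive_n f (S m)]. *)
enough (H : forall m, Ck O n (Derive_n f m)) by exact (H 0%nat).
induction n as [|n IH]; intros m; [exact I|].
exists (Derive_n f (S m)); split; [|apply IH].
intros x Ox; apply (Derive_correct (Derive_n f m)), (Hf x Ox (S m)).
Qed.

Lemma Cinf_Derive_n (O : R -> Prop) m f : open O -> Cinf O f -> Cinf O (Derive_n f m).
Proof. intros HO Hf n; apply Ck_Derive_n; auto. Qed.

Lemma Cinf_is_derive (O : R -> Prop) f x : Cinf O f -> O x ->
  is_derive f x (Derive f x).
Proof.
intros Hf Ox; destruct (Hf 1%nat) as [f' [H _]].
apply Derive_correct; exists (f' x); auto.
Qed.

Lemma Cinf_continuous (O : R -> Prop) f x : Cinf O f -> O x -> continuous f x.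
Proof.
intros Hf Ox; apply (ex_derive_continuous f).
exists (Derive f x); exact (Cinf_is_derive O f x Hf Ox).
Qed.

(** Trades pointwise neighbourhoods for a single open set, the form to which the closure properties
    of [Ck] apply. *)
Lemma smooth_on_quarterP (f : R -> R) :
  smooth_on_quarter f <->
  exists (O : R -> Prop) (F : R -> R),
    open O /\ (forall s, 0 <= s <= PI / 2 -> O s) /\ Cinf O F /\
    (forall s, 0 <= s <= PI / 2 -> F s = f s).
Proof.
split.
- intros [F [HF Ff]].
  (* The points with a neighbourhood of smoothness form an open set, since [locally] can be
     iterated. *)
  exists (fun x => locally x (fun y => forall n, ex_derive_n F n y)), F.
  repeat split; auto.
  + intros x Hx; exact (locally_locally x _ Hx).
  + apply ex_derive_n_Cinf; intros x Hx.
    exact (locally_singleton x _ Hx).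
- intros [O [F [HO [HU [HF Ff]]]]]; exists F; split; [|exact Ff].
  intros s Hs; apply (filter_imp O); [|exact (HO s (HU s Hs))].
  intros x Ox n; exact (Cinf_ex_derive_n O F HO HF n x Ox).
Qed.

(** * The weighted integrals *)

Lemma ball_R (x y : R) (d : posreal) : ball x d y <-> Rabs (y - x) < d.
Proof. reflexivity. Qed.

Lemma continuity_2d_pt_continuous_y (p : R -> R -> R) t s :
  continuity_2d_pt p t s -> continuous (p t) s.
Proof.
intros H; apply continuity_pt_filterlim, continuity_pt_locally.
intros eps; exact (locally_2d_1d_const_x _ _ _ (H eps)).
Qed.

Lemma ex_RInt_continuity_2d (p : R -> R -> R) t a b : a <= b ->
  (forall s, a <= s <= b -> continuity_2d_pt p t s) -> ex_RInt (p t) a b.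
Proof.
intros Hab Hp; apply (@ex_RInt_continuous R_CompleteNormedModule).
rewrite Rmin_left, Rmax_right by exact Hab.
intros s Hs; apply continuity_2d_pt_continuous_y; auto.
Qed.

(** Differentiation under the integral sign with an explicit integrand [p1] in place of [Derive].
    The hypotheses hold on a whole open set of parameters because integrability is needed at all
    parameters near [t]. *)
Lemma is_derive_RInt_param_open (T : R -> Prop) (p p1 : R -> R -> R) a b :
  open T -> a <= b ->
  (forall t s, T t -> a <= s <= b -> continuity_2d_pt p t s) ->
  (forall t s, T t -> a <= s <= b -> continuity_2d_pt p1 t s) ->
  (forall t s, T t -> a <= s <= b ->
     locally_2d (fun u v => is_derive (fun z => p z v) u (p1 u v)) t s) ->
  forall t, T t ->
    is_derive (fun x => RInt (p x) a b) t (RInt (p1 t) a b).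
Proof.
intros HT Hab Hp Hp1 Hd t Ht.
replace (RInt (p1 t) a b)
  with (RInt (fun s => Derive (fun u => p u s) t) a b).
- apply is_derive_RInt_param.
  + apply (filter_imp T); [|exact (HT t Ht)].
    rewrite Rmin_left, Rmax_right by exact Hab.
    intros u Tu s Hs; exists (p1 u s).
    exact (locally_2d_singleton _ _ _ (Hd u s Tu Hs)).
  + rewrite Rmin_left, Rmax_right by exact Hab.
    intros s Hs; apply (continuity_2d_pt_ext_loc p1); [|auto].
    destruct (Hd t s Ht Hs) as [d Hd']; exists d; intros u v Hu Hv.
    symmetry; apply is_derive_unique; auto.
  + apply (filter_imp T); [|exact (HT t Ht)].
    intros u Tu; apply (ex_RInt_continuity_2d p u); auto.
- apply RInt_ext; rewrite Rmin_left, Rmax_right by exact Hab.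
  intros s Hs; apply is_derive_unique.
  assert (Hs' : a <= s <= b) by lra.
  exact (locally_2d_singleton _ _ _ (Hd t s Ht Hs')).
Qed.

(** * Order of vanishing at the endpoints and the poles of the weight *)

Lemma sin_cos_sqr s : sin s ^ 2 + cos s ^ 2 = 1.
Proof. rewrite <- 2!Rsqr_pow2; apply sin2_cos2. Qed.

Definition sc (s : R) : R := sin s * cos s.

Lemma is_derive_sc s : is_derive sc s (cos s ^ 2 - sin s ^ 2).
Proof. unfold sc; auto_derive; [exact I | ring]. Qed.

Lemma sc_pos s : 0 < s < PI / 2 -> 0 < sc s.
Proof.
intros Hs; apply Rmult_lt_0_compat; [apply sin_gt_0 | apply cos_gt_0]; lra.
Qed.

Lemma continuity_2d_pt_bounded (p : R -> R -> R) t s : continuity_2d_pt p t s ->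
  exists M, 0 < M /\ locally_2d (fun u v => Rabs (p u v) <= M) t s.
Proof.
intros H; exists (Rabs (p t s) + 1); split.
- generalize (Rabs_pos (p t s)); lra.
- destruct (H (mkposreal 1 Rlt_0_1)) as [d Hd]; exists d; intros u v Hu Hv.
  specialize (Hd u v Hu Hv); simpl in Hd.
  replace (p u v) with (p u v - p t s + p t s) by ring.
  eapply Rle_trans; [apply Rabs_triang|]; lra.
Qed.

Lemma continuous_2d_y (f : R -> R) t s : continuous f s ->
  continuity_2d_pt (fun _ v => f v) t s.
Proof.
intros H; apply (continuity_1d_2d_pt_comp f (fun _ v => v)).
- apply continuity_pt_filterlim; exact H.
- apply continuity_2d_pt_id2.
Qed.

Lemma continuous_sc s : continuous sc s.
Proof. apply (ex_derive_continuous sc); eexists; apply is_derive_sc. Qed.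

(* A product of two functions of this order vanishes fast enough to absorb the
   simple poles of the weight at both endpoints. *)
Definition O_sc (p : R -> R -> R) (t s : R) : Prop :=
  exists M, 0 < M /\ locally_2d (fun u v => Rabs (p u v) <= M * Rabs (sc v)) t s.

Lemma O_sc_plus p q t s : O_sc p t s -> O_sc q t s ->
  O_sc (fun u v => p u v + q u v) t s.
Proof.
intros [M [HM Hp]] [N [HN Hq]]; exists (M + N); split; [lra|].
destruct (locally_2d_and _ _ _ _ Hp Hq) as [d Hd]; exists d; intros u v Hu Hv.
destruct (Hd u v Hu Hv).
eapply Rle_trans; [apply Rabs_triang|]; lra.
Qed.

Lemma O_sc_mult p q t s : continuity_2d_pt p t s -> O_sc q t s ->
  O_sc (fun u v => p u v * q u v) t s.
Proof.
intros Cp [N [HN Hq]].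
destruct (continuity_2d_pt_bounded p t s Cp) as [M [HM Hp]].
exists (M * N); split; [nra|].
destruct (locally_2d_and _ _ _ _ Hp Hq) as [d Hd]; exists d; intros u v Hu Hv.
destruct (Hd u v Hu Hv); rewrite Rabs_mult, Rmult_assoc.
apply Rmult_le_compat; auto using Rabs_pos.
Qed.

(** Away from the zeros of [sc] the quotient [p / sc] is continuous, hence locally bounded. *)
Lemma O_sc_interior p t s : sc s <> 0 -> continuity_2d_pt p t s -> O_sc p t s.
Proof.
intros Hs Cp.
assert (Csc : continuity_2d_pt (fun _ v => sc v) t s)
  by apply continuous_2d_y, continuous_sc.
destruct (continuity_2d_pt_bounded (fun u v => p u v * / sc v) t s) as [M [HM H]].
- apply continuity_2d_pt_mult; [exact Cp|].
  apply continuity_2d_pt_inv; assumption.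
- exists M; split; [exact HM|].
  destruct (locally_2d_and _ _ _ _ H (continuity_2d_pt_neq_0 _ _ _ Csc Hs)) as [d Hd].
  exists d; intros u v Hu Hv; destruct (Hd u v Hu Hv) as [Hb Hn].
  replace (p u v) with (p u v * / sc v * sc v) by (field; exact Hn).
  rewrite Rabs_mult; apply Rmult_le_compat_r; [apply Rabs_pos | exact Hb].
Qed.

(** A mean value theorem indifferent to the order of [a] and [b]; the predicate [P] carries a bound
    on the derivative over to the mean value. *)
Lemma MVT_abs (f df : R -> R) a b (P : R -> Prop) :
  (forall x, Rabs (x - a) <= Rabs (b - a) -> is_derive f x (df x) /\ P (df x)) ->
  exists d, P d /\ f b - f a = d * (b - a).
Proof.
intros H.
assert (Hx : forall x, Rmin a b <= x <= Rmax a b -> Rabs (x - a) <= Rabs (b - a)).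
{ intros x; unfold Rmin, Rmax; destruct (Rle_dec a b); intros Hx;
  unfold Rabs; repeat destruct Rcase_abs; lra. }
destruct (MVT_gen f a b df) as [c [Hc Hf]].
- intros x Hx'; apply H, Hx; lra.
- intros x Hx'; apply continuity_pt_filterlim, (ex_derive_continuous f).
  exists (df x); apply H, Hx; exact Hx'.
- exists (df c); split; [apply H, Hx; exact Hc | exact Hf].
Qed.

(** At a zero of [sc] its derivative is 1 or -1, so nearby it stays at least 1/2 in absolute value;
    the mean value theorem then gives the factor 2. *)
Lemma sc_lower_bound s : sc s = 0 ->
  locally s (fun v => Rabs (v - s) <= 2 * Rabs (sc v)).
Proof.
intros Hs.
assert (H2 := sin_cos_sqr s).
assert (H0 : Rabs (cos s ^ 2 - sin s ^ 2) = 1).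
{ destruct (Rmult_integral _ _ Hs) as [E|E]; rewrite E in *.
  - replace (cos s ^ 2 - 0 ^ 2) with 1 by lra; apply Rabs_R1.
  - replace (0 ^ 2 - sin s ^ 2) with (- (1)) by lra.
    rewrite Rabs_Ropp; apply Rabs_R1. }
assert (Cd : continuous (fun x => cos x ^ 2 - sin x ^ 2) s)
  by (apply (ex_derive_continuous (fun x => cos x ^ 2 - sin x ^ 2));
      auto_derive; exact I).
apply continuity_pt_filterlim in Cd.
destruct (proj1 (continuity_pt_locally _ _) Cd (mkposreal (/ 2) ltac:(lra))) as [d Hd].
exists d; intros v Hv; apply ball_R in Hv.
destruct (MVT_abs sc (fun x => cos x ^ 2 - sin x ^ 2) s v
            (fun y => / 2 <= Rabs y)) as [y [Hy E]].
- intros x Hx; split; [apply is_derive_sc|].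
  specialize (Hd x (Rle_lt_trans _ _ _ Hx Hv)); cbv beta in Hd.
  change (pos (mkposreal (/ 2) _)) with (/ 2) in Hd.
  set (X := cos x ^ 2 - sin x ^ 2) in *; set (S := cos s ^ 2 - sin s ^ 2) in *.
  generalize (Rabs_triang_inv S (S - X)).
  replace (S - (S - X)) with X by ring.
  rewrite (Rabs_minus_sym S); lra.
- rewrite Hs, Rminus_0_r in E; rewrite E, Rabs_mult.
  generalize (Rabs_pos (v - s)); nra.
Qed.

(** The mean value theorem in the second variable, starting from the line where [p] vanishes, bounds
    [p u v] by a multiple of the distance from [v] to [s], and [sc_lower_bound] compares that
    distance with [sc v]. *)
Lemma O_sc_boundary (p p2 : R -> R -> R) t s :
  sc s = 0 -> locally t (fun u => p u s = 0) ->
  locally_2d (fun u v => is_derive (p u) v (p2 u v)) t s ->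
  continuity_2d_pt p2 t s ->
  O_sc p t s.
Proof.
intros Hs Hp0 Hp2 Cp2.
destruct (continuity_2d_pt_bounded p2 t s Cp2) as [M [HM Hb]].
exists (M * 2); split; [lra|].
destruct (locally_2d_and _ _ _ _ Hp2 Hb) as [d1 H1].
destruct Hp0 as [d2 H2]; destruct (sc_lower_bound s Hs) as [d3 H3].
exists (mkposreal _ (Rmin_stable_in_posreal d1 (mkposreal _ (Rmin_stable_in_posreal d2 d3)))).
simpl; intros u v Hu Hv.
assert (Hm1 := Rmin_l d1 (Rmin d2 d3)); assert (Hm2 := Rmin_r d1 (Rmin d2 d3)).
assert (Hm3 := Rmin_l d2 d3); assert (Hm4 := Rmin_r d2 d3).
destruct (MVT_abs (p u) (p2 u) s v (fun y => Rabs y <= M)) as [y [Hy E]].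
- intros x Hx; apply H1; lra.
- rewrite (H2 u) in E by (apply ball_R; lra).
  rewrite Rminus_0_r in E; rewrite E, Rabs_mult, Rmult_assoc.
  apply Rmult_le_compat; auto using Rabs_pos.
  apply H3, ball_R; lra.
Qed.

(** This is [k^2 tan + l^2 cot] over a common denominator, so that all poles are zeros of [sc]. *)
Definition weight (k l : Z) (s : R) : R :=
  (IZR k ^ 2 * sin s ^ 2 + IZR l ^ 2 * cos s ^ 2) / sc s.

Lemma continuous_weight k l s : sc s <> 0 -> continuous (weight k l) s.
Proof.
intros Hs; apply (ex_derive_continuous (weight k l)).
unfold weight, sc in *; auto_derive; exact Hs.
Qed.

(** At a zero of [sc] the weight is at most of order [1 / sc] while the product [p q] is of order
    [sc ^ 2], so the whole is squeezed to 0. *)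
Lemma continuity_2d_pt_weight k l p q t s :
  continuity_2d_pt p t s -> continuity_2d_pt q t s ->
  O_sc p t s -> O_sc q t s ->
  continuity_2d_pt (fun u v => weight k l v * (p u v * q u v)) t s.
Proof.
intros Cp Cq Vp Vq.
destruct (Req_dec (sc s) 0) as [Hs|Hs].
- destruct Vp as [M [HM Hp]]; destruct Vq as [N [HN Hq]].
  set (K := IZR k ^ 2 + IZR l ^ 2 + 1).
  assert (HK : 0 < K) by (unfold K; nra).
  assert (Hb : locally_2d (fun u v =>
            Rabs (weight k l v * (p u v * q u v)) <= K * M * N * Rabs (sc v)) t s).
  { destruct (locally_2d_and _ _ _ _ Hp Hq) as [d Hd].
    exists d; intros u v Hu Hv; destruct (Hd u v Hu Hv) as [H1 H2].
    assert (H0 := Rabs_pos (sc v)).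
    destruct (Req_dec (sc v) 0) as [Hv0|Hv0].
    (* Here the weight divides by zero; its value is irrelevant because the bound on [p] forces
       [p u v] to be 0. *)
    - rewrite Hv0, Rabs_R0, Rmult_0_r in H1.
      rewrite (Rabs_eq_0 (p u v))
        by (apply Rle_antisym; [exact H1 | apply Rabs_pos]).
      rewrite Rmult_0_l, Rmult_0_r, Rabs_R0.
      apply Rmult_le_pos; [|exact H0].
      apply Rlt_le, Rmult_lt_0_compat; [nra | exact HN].
    - unfold weight; rewrite Rabs_mult, Rabs_div, Rabs_mult by exact Hv0.
      assert (Hw : Rabs (IZR k ^ 2 * sin v ^ 2 + IZR l ^ 2 * cos v ^ 2) <= K).
      { assert (E := sin_cos_sqr v).
        assert (A1 := pow2_ge_0 (sin v)); assert (A2 := pow2_ge_0 (cos v)).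
        assert (A3 := pow2_ge_0 (IZR k)); assert (A4 := pow2_ge_0 (IZR l)).
        rewrite Rabs_pos_eq by nra; unfold K; nra. }
      assert (Hpos : 0 < Rabs (sc v)) by (apply Rabs_pos_lt; exact Hv0).
      apply Rmult_le_reg_r with (Rabs (sc v)); [exact Hpos|].
      replace (Rabs (IZR k ^ 2 * sin v ^ 2 + IZR l ^ 2 * cos v ^ 2) / Rabs (sc v) *
               (Rabs (p u v) * Rabs (q u v)) * Rabs (sc v))
        with (Rabs (IZR k ^ 2 * sin v ^ 2 + IZR l ^ 2 * cos v ^ 2) *
               (Rabs (p u v) * Rabs (q u v))) by (field; lra).
      replace (K * M * N * Rabs (sc v) * Rabs (sc v))
        with (K * ((M * Rabs (sc v)) * (N * Rabs (sc v)))) by ring.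
      apply Rmult_le_compat; auto using Rabs_pos.
      + apply Rmult_le_pos; apply Rabs_pos.
      + apply Rmult_le_compat; auto using Rabs_pos. }
  (* The estimate [Hb] includes the centre, so the value there agrees with the limit 0. *)
  assert (E : weight k l s * (p t s * q t s) = 0).
  { apply locally_2d_singleton in Hb; rewrite Hs, Rabs_R0, Rmult_0_r in Hb.
    apply Rabs_eq_0, Rle_antisym; [exact Hb | apply Rabs_pos]. }
  intros eps; rewrite E.
  assert (Csc : continuity_2d_pt (fun _ v => sc v) t s)
    by apply continuous_2d_y, continuous_sc.
  assert (Hk : 0 < K * M * N) by (apply Rmult_lt_0_compat; [nra | exact HN]).
  destruct (locally_2d_and _ _ _ _ Hb
    (Csc (mkposreal (eps / (K * M * N)) (Rdiv_lt_0_compat _ _ (cond_pos eps) Hk))))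
    as [d Hd].
  exists d; intros u v Hu Hv; destruct (Hd u v Hu Hv) as [H1 H2]; simpl in H2.
  rewrite Hs, Rminus_0_r in H2; rewrite Rminus_0_r.
  apply (Rmult_lt_compat_l _ _ _ Hk) in H2.
  replace (K * M * N * (eps / (K * M * N))) with (pos eps) in H2 by (field; nra).
  lra.
- apply continuity_2d_pt_mult; [|apply continuity_2d_pt_mult; assumption].
  apply continuous_2d_y, continuous_weight, Hs.
Qed.

(** * Energy along a variation *)

Definition pdt (f : R -> R -> R) (u v : R) : R := Derive (fun z => f z v) u.
Definition pds (f : R -> R -> R) (u v : R) : R := Derive (fun z => f u z) v.

Definition smooth2_at (f : R -> R -> R) (t s : R) : Prop :=
  locally_2d (fun u v => forall n, ex_diff_n f n u v) t s.

Lemma smooth2_at_pdt f t s : smooth2_at f t s -> smooth2_at (pdt f) t s.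
Proof.
intros [d H]; exists d; intros u v Hu Hv n.
exact (ex_diff_n_deriv_aux1 f n u v (H u v Hu Hv (S n))).
Qed.

Lemma smooth2_at_pds f t s : smooth2_at f t s -> smooth2_at (pds f) t s.
Proof.
intros [d H]; exists d; intros u v Hu Hv n.
exact (ex_diff_n_deriv_aux2 f n u v (H u v Hu Hv (S n))).
Qed.

Lemma smooth2_at_continuity f t s : smooth2_at f t s -> continuity_2d_pt f t s.
Proof. intros H; exact (proj1 (locally_2d_singleton _ _ _ H 0%nat)). Qed.

Lemma smooth2_at_is_derive1 f t s : smooth2_at f t s ->
  locally_2d (fun u v => is_derive (fun z => f z v) u (pdt f u v)) t s.
Proof.
intros [d H]; exists d; intros u v Hu Hv.
apply Derive_correct, (H u v Hu Hv 1%nat).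
Qed.

Lemma smooth2_at_is_derive2 f t s : smooth2_at f t s ->
  locally_2d (fun u v => is_derive (f u) v (pds f u v)) t s.
Proof.
intros [d H]; exists d; intros u v Hu Hv.
apply Derive_correct, (H u v Hu Hv 1%nat).
Qed.

(** Two separate factors are allowed because the first derivative of the energy has the square of
    [dcos] to differentiate, the second the product of [dcos] and [2 * dcos1]. *)
Lemma is_derive_weighted (T : R -> Prop) k l (p q p1 q1 : R -> R -> R) :
  open T ->
  (forall t s, T t -> 0 <= s <= PI / 2 ->
    (continuity_2d_pt p t s /\ O_sc p t s) /\
    (continuity_2d_pt q t s /\ O_sc q t s) /\
    (continuity_2d_pt p1 t s /\ O_sc p1 t s) /\
    (continuity_2d_pt q1 t s /\ O_sc q1 t s) /\
    locally_2d (fun u v => is_derive (fun z => p z v) u (p1 u v)) t s /\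
    locally_2d (fun u v => is_derive (fun z => q z v) u (q1 u v)) t s) ->
  forall t, T t ->
    is_derive (fun x => RInt (fun s => weight k l s * (p x s * q x s)) 0 (PI / 2)) t
      (RInt (fun s => weight k l s * (p1 t s * q t s + p t s * q1 t s)) 0 (PI / 2)).
Proof.
intros HT H.
apply (is_derive_RInt_param_open T (fun t s => weight k l s * (p t s * q t s))
  (fun t s => weight k l s * (p1 t s * q t s + p t s * q1 t s))).
- exact HT.
- generalize PI_RGT_0; lra.
- intros t s Ht Hs; destruct (H t s Ht Hs) as [[? ?] [[? ?] _]].
  apply continuity_2d_pt_weight; assumption.
- intros t s Ht Hs; destruct (H t s Ht Hs) as [[? ?] [[? ?] [[? ?] [[? ?] _]]]].
  apply (continuity_2d_pt_ext (fun t s => weight k l s * (p1 t s * q t s) +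
                                         weight k l s * (p t s * q1 t s))).
  + intros; ring.
  + apply continuity_2d_pt_plus; apply continuity_2d_pt_weight; assumption.
- intros t s Ht Hs; destruct (H t s Ht Hs) as [_ [_ [_ [_ [Hp Hq]]]]].
  destruct (locally_2d_and _ _ _ _ Hp Hq) as [d Hd]; exists d; intros u v Hu Hv.
  destruct (Hd u v Hu Hv) as [H1 H2].
  apply (is_derive_scal (fun z => p z v * q z v)).
  apply (is_derive_mult (fun z => p z v) (fun z => q z v) u (p1 u v) (q1 u v));
    [exact H1 | exact H2 | intros; apply Rmult_comm].
Qed.

(** What a variation passes on to its smooth extension [F], whose partial derivatives make sense up
    to the endpoints of the interval. *)
Definition fixed_ends (eps : R) (F : R -> R -> R) : Prop :=
  0 < eps /\
  (forall t s, - eps < t < eps -> 0 <= s <= PI / 2 -> smooth2_at F t s) /\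
  (forall t, - eps < t < eps -> F t 0 = 0 /\ F t (PI / 2) = PI).

(* [dcos F] is minus the s-derivative of [cos F]; [dcos1] and [dcos2] are its
   t-derivatives. *)
Definition dcos (F : R -> R -> R) (t s : R) : R := pds F t s * sin (F t s).

Definition dcos1 (F : R -> R -> R) (t s : R) : R :=
  pdt (pds F) t s * sin (F t s) + (pds F t s * cos (F t s)) * pdt F t s.

Definition dcos2 (F : R -> R -> R) (t s : R) : R :=
  pdt (pdt (pds F)) t s * sin (F t s)
  + (2 * pdt (pds F) t s * cos (F t s) - pds F t s * pdt F t s * sin (F t s)) * pdt F t s
  + (pds F t s * cos (F t s)) * pdt (pdt F) t s.

Lemma sc_0_or_interior s : 0 <= s <= PI / 2 ->
  (s = 0 \/ s = PI / 2) /\ sc s = 0 \/ 0 < s < PI / 2 /\ sc s <> 0.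
Proof.
intros Hs; unfold sc.
destruct (Req_dec s 0) as [->|H0]; [left; rewrite sin_0; split; [auto | ring]|].
destruct (Req_dec s (PI / 2)) as [->|H1];
  [left; rewrite cos_PI2; split; [auto | ring]|].
right; assert (H : 0 < s < PI / 2) by lra.
split; [exact H | apply Rgt_not_eq, sc_pos, H].
Qed.

Lemma open_sym_interval eps : open (fun t => - eps < t < eps).
Proof. apply open_and; [apply open_gt | apply open_lt]. Qed.

Lemma locally_sym_interval (P : R -> Prop) eps t : - eps < t < eps ->
  (forall u, - eps < u < eps -> P u) -> locally t P.
Proof.
intros Ht H; exact (filter_imp _ _ H (open_sym_interval eps t Ht)).
Qed.

Lemma O_sc_of_boundary eps (p p2 : R -> R -> R) t s :
  - eps < t < eps -> 0 <= s <= PI / 2 ->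
  (forall u, - eps < u < eps -> p u 0 = 0 /\ p u (PI / 2) = 0) ->
  continuity_2d_pt p t s ->
  locally_2d (fun u v => is_derive (p u) v (p2 u v)) t s ->
  continuity_2d_pt p2 t s ->
  O_sc p t s.
Proof.
intros Ht Hs Hp Cp Hd C2.
destruct (sc_0_or_interior s Hs) as [[Hb H0]|[_ H0]].
- apply (O_sc_boundary p p2); auto.
  apply (locally_sym_interval _ eps); [exact Ht|].
  intros u Hu; destruct (Hp u Hu); destruct Hb as [->| ->]; assumption.
- apply O_sc_interior; assumption.
Qed.

(** General boundary values permit a second application, to [pdt F] with both values 0, after the
    first one with 0 and [PI]. *)
Lemma fixed_ends_pdt_boundary eps F (c0 c1 : R) :
  (forall t, - eps < t < eps -> F t 0 = c0 /\ F t (PI / 2) = c1) ->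
  forall t, - eps < t < eps -> pdt F t 0 = 0 /\ pdt F t (PI / 2) = 0.
Proof.
intros H t Ht; unfold pdt; split.
- rewrite (Derive_ext_loc _ (fun _ => c0)), Derive_const; [reflexivity|].
  apply (locally_sym_interval _ eps); [exact Ht|]; intros; apply H; assumption.
- rewrite (Derive_ext_loc _ (fun _ => c1)), Derive_const; [reflexivity|].
  apply (locally_sym_interval _ eps); [exact Ht|]; intros; apply H; assumption.
Qed.

Lemma continuity_2d_pt_sin p t s : continuity_2d_pt p t s ->
  continuity_2d_pt (fun u v => sin (p u v)) t s.
Proof. apply continuity_1d_2d_pt_comp, continuity_sin. Qed.

Lemma continuity_2d_pt_cos p t s : continuity_2d_pt p t s ->
  continuity_2d_pt (fun u v => cos (p u v)) t s.
Proof. apply continuity_1d_2d_pt_comp, continuity_cos. Qed.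

Ltac cont2 := repeat first
  [ apply continuity_2d_pt_const
  | apply continuity_2d_pt_minus | apply continuity_2d_pt_plus
  | apply continuity_2d_pt_mult | apply continuity_2d_pt_sin
  | apply continuity_2d_pt_cos
  | solve [apply smooth2_at_continuity; 
        repeat first [assumption | apply smooth2_at_pdt | apply smooth2_at_pds]] ].

(** All three functions vanish at both endpoints: [F] is 0 or [PI] there for every [t], so its sine
    and its [t]-derivatives are 0. *)
Lemma O_sc_fixed_ends eps F t s : fixed_ends eps F ->
  - eps < t < eps -> 0 <= s <= PI / 2 ->
  O_sc (fun u v => sin (F u v)) t s /\ O_sc (pdt F) t s /\ O_sc (pdt (pdt F)) t s.
Proof.
intros [_ [HF Hb]] Ht Hs; specialize (HF t s Ht Hs).
assert (Hb1 := fixed_ends_pdt_boundary eps F 0 PI Hb).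
assert (Hb2 := fixed_ends_pdt_boundary eps (pdt F) 0 0 Hb1).
assert (HF1 := smooth2_at_pdt _ _ _ HF); assert (HF11 := smooth2_at_pdt _ _ _ HF1).
repeat split.
- apply (O_sc_of_boundary eps _ (fun u v => pds F u v * cos (F u v))); auto.
  + intros u Hu; destruct (Hb u Hu) as [-> ->]; split; [apply sin_0 | apply sin_PI].
  + cont2.
  + destruct (smooth2_at_is_derive2 F t s HF) as [d Hd]; exists d; intros u v Hu Hv.
    apply (is_derive_comp sin (F u)); [apply is_derive_sin | apply Hd; assumption].
  + cont2.
- apply (O_sc_of_boundary eps _ (pds (pdt F))); auto.
  + cont2.
  + apply smooth2_at_is_derive2, HF1.
  + cont2.
- apply (O_sc_of_boundary eps _ (pds (pdt (pdt F)))); auto.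
  + cont2.
  + apply smooth2_at_is_derive2, HF11.
  + cont2.
Qed.

(** Every summand of [dcos], [dcos1] and [dcos2] is a continuous function times [sin F], [pdt F] or
    [pdt (pdt F)]; their definitions are bracketed so that this factor comes last. *)
Lemma dcos_regular eps F t s : fixed_ends eps F ->
  - eps < t < eps -> 0 <= s <= PI / 2 ->
  (continuity_2d_pt (dcos F) t s /\ O_sc (dcos F) t s) /\
  (continuity_2d_pt (dcos1 F) t s /\ O_sc (dcos1 F) t s) /\
  (continuity_2d_pt (dcos2 F) t s /\ O_sc (dcos2 F) t s).
Proof.
intros HFE Ht Hs.
destruct (O_sc_fixed_ends eps F t s HFE Ht Hs) as [V0 [V1 V2]].
destruct HFE as [_ [HF _]]; specialize (HF t s Ht Hs).
unfold dcos, dcos1, dcos2; repeat split.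
- cont2.
- apply O_sc_mult; [cont2 | exact V0].
- cont2.
- apply O_sc_plus; apply O_sc_mult; try assumption; cont2.
- cont2.
- apply O_sc_plus; [apply O_sc_plus|]; apply O_sc_mult; try assumption; cont2.
Qed.

Lemma is_derive_dcos F t s : smooth2_at F t s ->
  locally_2d (fun u v => is_derive (fun z => dcos F z v) u (dcos1 F u v)) t s.
Proof.
intros HF.
destruct (locally_2d_and _ _ _ _ (smooth2_at_is_derive1 F t s HF)
   (smooth2_at_is_derive1 (pds F) t s (smooth2_at_pds _ _ _ HF))) as [d Hd].
exists d; intros u v Hu Hv; destruct (Hd u v Hu Hv) as [H1 H2].
unfold dcos.
evar_last.
- apply (is_derive_mult (fun z => pds F z v) (fun z => sin (F z v)) u
    (pdt (pds F) u v) (pdt F u v * cos (F u v))); [exact H2 | |intros; apply Rmult_comm].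
  apply (is_derive_comp sin (fun z => F z v)); [apply is_derive_sin | exact H1].
- unfold dcos1, plus, mult; simpl; ring.
Qed.

Lemma is_derive_dcos1 F t s : smooth2_at F t s ->
  locally_2d (fun u v => is_derive (fun z => dcos1 F z v) u (dcos2 F u v)) t s.
Proof.
intros HF.
destruct (locally_2d_and _ _ _ _ 
 (locally_2d_and _ _ _ _ (smooth2_at_is_derive1 F t s HF)
   (smooth2_at_is_derive1 (pds F) t s (smooth2_at_pds _ _ _ HF)))
 (locally_2d_and _ _ _ _
   (smooth2_at_is_derive1 (pdt F) t s (smooth2_at_pdt _ _ _ HF))
   (smooth2_at_is_derive1 (pdt (pds F)) t s (smooth2_at_pdt _ _ _ (smooth2_at_pds _ _ _ HF)))))
 as [d Hd].
exists d; intros u v Hu Hv; destruct (Hd u v Hu Hv) as [[H1 H2] [H3 H4]].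
unfold dcos1; auto_derive.
- repeat split; eexists; eassumption.
- fold (pdt (pdt (pds F)) u v) (pdt F u v) (pdt (pds F) u v) (pdt (pdt F) u v).
  unfold dcos2; ring.
Qed.

(** A primitive is [- cos F], and the fixed boundary values 0 and [PI] contribute 1 each. *)
Lemma RInt_dcos eps F t : fixed_ends eps F -> - eps < t < eps ->
  RInt (dcos F t) 0 (PI / 2) = 2.
Proof.
intros HFE Ht; assert (HP := PI_RGT_0).
apply is_RInt_unique.
evar_last.
- apply (is_RInt_derive (fun s => - cos (F t s)) (dcos F t));
    rewrite Rmin_left, Rmax_right by lra; intros s Hs.
  + destruct HFE as [_ [HF _]]; specialize (HF t s Ht Hs).
    apply smooth2_at_is_derive2, locally_2d_singleton in HF.
    evar_last.
    * apply (is_derive_opp (fun s => cos (F t s))), (is_derive_comp cos (F t));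
        [apply is_derive_cos | exact HF].
    * unfold dcos, opp, scal; simpl; unfold mult; simpl; ring.
  + apply continuity_2d_pt_continuous_y, (dcos_regular eps); assumption.
- destruct HFE as [_ [_ Hb]]; destruct (Hb t Ht) as [-> ->].
  rewrite cos_0, cos_PI; unfold minus, plus, opp; simpl; ring.
Qed.

Lemma is_derive_0_of_const (f : R -> R) eps c d t :
  - eps < t < eps -> (forall u, - eps < u < eps -> f u = c) ->
  is_derive f t d -> d = 0.
Proof.
intros Ht Hf Hd; rewrite <- (is_derive_unique _ _ _ Hd).
rewrite (Derive_ext_loc f (fun _ => c)); [apply Derive_const|].
apply (locally_sym_interval _ eps); assumption.
Qed.

(** The integral is the [t]-derivative of the constant 2 from [RInt_dcos]; [RInt_dcos2]
    differentiates once more. *)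
Lemma RInt_dcos1 eps F t : fixed_ends eps F -> - eps < t < eps ->
  RInt (dcos1 F t) 0 (PI / 2) = 0.
Proof.
intros HFE Ht.
apply (is_derive_0_of_const (fun x => RInt (dcos F x) 0 (PI / 2)) eps 2 _ t); auto.
- intros u Hu; apply (RInt_dcos eps); assumption.
- apply (is_derive_RInt_param_open (fun t => - eps < t < eps)).
  + apply open_sym_interval.
  + generalize PI_RGT_0; lra.
  + intros u s Hu Hs; apply (dcos_regular eps F u s HFE Hu Hs).
  + intros u s Hu Hs; apply (dcos_regular eps F u s HFE Hu Hs).
  + intros u s Hu Hs; apply is_derive_dcos, HFE; assumption.
  + exact Ht.
Qed.

Lemma RInt_dcos2 eps F t : fixed_ends eps F -> - eps < t < eps ->
  RInt (dcos2 F t) 0 (PI / 2) = 0.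
Proof.
intros HFE Ht.
apply (is_derive_0_of_const (fun x => RInt (dcos1 F x) 0 (PI / 2)) eps 0 _ t); auto.
- intros u Hu; apply (RInt_dcos1 eps); assumption.
- apply (is_derive_RInt_param_open (fun t => - eps < t < eps)).
  + apply open_sym_interval.
  + generalize PI_RGT_0; lra.
  + intros u s Hu Hs; apply (dcos_regular eps F u s HFE Hu Hs).
  + intros u s Hu Hs; apply (dcos_regular eps F u s HFE Hu Hs).
  + intros u s Hu Hs; apply is_derive_dcos1, HFE; assumption.
  + exact Ht.
Qed.

(** * First and second derivatives of the energy, and stability *)

Lemma O_sc_double p t s : continuity_2d_pt p t s /\ O_sc p t s ->
  continuity_2d_pt (fun u v => 2 * p u v) t s /\ O_sc (fun u v => 2 * p u v) t s.
Proof.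
intros [Cp Vp]; split.
- apply continuity_2d_pt_mult; [apply continuity_2d_pt_const | exact Cp].
- apply (O_sc_mult (fun _ _ => 2)); [apply continuity_2d_pt_const | exact Vp].
Qed.

Lemma is_derive_weighted_dcos k l eps F t : fixed_ends eps F -> - eps < t < eps ->
  is_derive (fun x => RInt (fun s => weight k l s * (dcos F x s * dcos F x s)) 0 (PI / 2)) t
    (RInt (fun s => weight k l s * (dcos F t s * (2 * dcos1 F t s))) 0 (PI / 2)).
Proof.
intros HFE Ht.
rewrite (RInt_ext _ (fun s => weight k l s *
  (dcos1 F t s * dcos F t s + dcos F t s * dcos1 F t s)))
  by (intros; simpl; ring).
apply (is_derive_weighted (fun t => - eps < t < eps)); [apply open_sym_interval| |exact Ht].
intros u s Hu Hs; destruct (dcos_regular eps F u s HFE Hu Hs) as [H0 [H1 _]].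
assert (Hd := is_derive_dcos F u s (proj1 (proj2 HFE) u s Hu Hs)).
tauto.
Qed.

Lemma is_derive_weighted_dcos1 k l eps F t : fixed_ends eps F -> - eps < t < eps ->
  is_derive (fun x => RInt (fun s => weight k l s * (dcos F x s * (2 * dcos1 F x s))) 0 (PI / 2)) t
    (RInt (fun s => weight k l s *
       (dcos1 F t s * (2 * dcos1 F t s) + dcos F t s * (2 * dcos2 F t s))) 0 (PI / 2)).
Proof.
intros HFE Ht.
apply (is_derive_weighted (fun t => - eps < t < eps) k l _ (fun u v => 2 * dcos1 F u v)
  _ (fun u v => 2 * dcos2 F u v)); [apply open_sym_interval| |exact Ht].
intros u s Hu Hs; destruct (dcos_regular eps F u s HFE Hu Hs) as [H0 [H1 H2]].
assert (HF := proj1 (proj2 HFE) u s Hu Hs).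
assert (Hd := is_derive_dcos F u s HF).
assert (Hd1 : locally_2d (fun u v => is_derive (fun z => 2 * dcos1 F z v) u (2 * dcos2 F u v)) u s).
{ destruct (is_derive_dcos1 F u s HF) as [d H]; exists d; intros x y Hx Hy.
  apply (is_derive_scal (fun z => dcos1 F z y)); auto. }
generalize (O_sc_double _ _ _ H1) (O_sc_double _ _ _ H2); tauto.
Qed.

(** Minus the weight times the derivative of [cos alpha]. *)
Definition flux (k l : Z) (alpha : R -> R) (s : R) : R :=
  weight k l s * (Derive alpha s * sin (alpha s)).

Lemma energy_weight r k l F A t :
  (forall s, 0 <= s <= PI / 2 -> F t s = A t s) ->
  energy r k l (A t) =
  2 * PI ^ 2 / r * RInt (fun s => weight k l s * (dcos F t s * dcos F t s)) 0 (PI / 2).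
Proof.
intros H; assert (HP := PI_RGT_0); unfold energy; f_equal.
apply RInt_ext; rewrite Rmin_left, Rmax_right by lra; intros s Hs.
rewrite <- H by lra.
replace (Derive (A t) s) with (pds F t s).
- assert (Hsc := sc_pos s Hs); unfold sc in Hsc.
  unfold weight, dcos, sc, tan; simpl; field; split; nra.
(* The extension and the variation agree only on the closed interval, which determines the
   derivative at interior points. *)
- apply Derive_ext_loc.
  apply (filter_imp (fun x => 0 < x /\ x < PI / 2)).
  + intros x Hx; apply H; lra.
  + apply (open_and _ _ (open_gt 0) (open_lt (PI / 2))); exact Hs.
Qed.

Lemma variation_fixed_ends alpha eps A : variation alpha eps A ->
  exists F, fixed_ends eps F /\
    (forall t s, - eps < t < eps -> 0 <= s <= PI / 2 -> F t s = A t s).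
Proof.
intros [He [[F [HF FA]] [_ HA]]]; exists F; split; [|exact FA].
split; [exact He|]; split; [exact HF|].
intros t Ht; assert (HP := PI_RGT_0).
rewrite 2!FA by lra; exact (HA t Ht).
Qed.

Lemma locally_interior s : 0 < s < PI / 2 -> locally s (fun x => 0 < x < PI / 2).
Proof. apply (open_and _ _ (open_gt 0) (open_lt (PI / 2))). Qed.

Lemma weighted_dcos_0 k l alpha eps A F c :
  variation alpha eps A ->
  (forall t s, - eps < t < eps -> 0 <= s <= PI / 2 -> F t s = A t s) ->
  (forall s, 0 < s < PI / 2 -> flux k l alpha s = c) ->
  forall s, 0 < s < PI / 2 -> weight k l s * dcos F 0 s = c.
Proof.
intros [He [_ [HA _]]] HF Hc s Hs; rewrite <- (Hc s Hs); unfold flux, dcos, pds.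
assert (E : forall x, 0 < x < PI / 2 -> F 0 x = alpha x)
  by (intros x Hx; rewrite HF, HA by lra; reflexivity).
rewrite E by exact Hs; do 2 f_equal.
apply Derive_ext_loc, (filter_imp _ _ E), locally_interior, Hs.
Qed.

(** Established at every [t] of the interval and not just at 0, so that the formula can itself be
    differentiated for the second variation. *)
Lemma is_derive_energy r k l eps F A t : fixed_ends eps F ->
  (forall t s, - eps < t < eps -> 0 <= s <= PI / 2 -> F t s = A t s) ->
  - eps < t < eps ->
  is_derive (fun t => energy r k l (A t)) t (2 * PI ^ 2 / r *
    RInt (fun s => weight k l s * (dcos F t s * (2 * dcos1 F t s))) 0 (PI / 2)).
Proof.
intros HF FA Ht.
apply (is_derive_ext_loc (fun x => 2 * PI ^ 2 / r *
  RInt (fun s => weight k l s * (dcos F x s * dcos F x s)) 0 (PI / 2))).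
- apply (locally_sym_interval _ eps); [exact Ht|]; intros u Hu.
  symmetry; apply energy_weight; auto.
- apply (is_derive_scal (fun x =>
    RInt (fun s => weight k l s * (dcos F x s * dcos F x s)) 0 (PI / 2))).
  apply (is_derive_weighted_dcos k l eps); assumption.
Qed.

Lemma flux_const_stable r k l alpha c : 0 < r ->
  (forall s, 0 < s < PI / 2 -> flux k l alpha s = c) ->
  stable_critical r k l alpha.
Proof.
intros Hr Hc; assert (HP := PI_RGT_0).
assert (Hpos : 0 <= 2 * PI ^ 2 / r)
  by (apply Rlt_le, Rdiv_lt_0_compat; [nra | exact Hr]).
split.
- intros eps A HA; destruct (variation_fixed_ends _ _ _ HA) as [F [HF FA]].
  assert (He := proj1 HA); assert (H0 : - eps < 0 < eps) by lra.
  evar_last; [apply (is_derive_energy r k l eps F A 0 HF FA H0)|].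
  (* Constant flux turns weight times [dcos] into [c], which leaves [2 c] times the vanishing
     integral of [dcos1]. *)
  rewrite (RInt_ext _ (fun s => scal (2 * c) (dcos1 F 0 s))).
  + rewrite (RInt_scal (dcos1 F 0)).
    * rewrite (RInt_dcos1 eps) by assumption; unfold scal; simpl; unfold mult; simpl; ring.
    * apply ex_RInt_continuity_2d; [lra|].
      intros s Hs; apply (dcos_regular eps F 0 s HF H0 Hs).
  + rewrite Rmin_left, Rmax_right by lra; intros s Hs.
    rewrite <- (weighted_dcos_0 k l alpha eps A F c HA FA Hc s Hs).
    unfold scal; simpl; unfold mult; simpl; ring.
- intros eps A HA; destruct (variation_fixed_ends _ _ _ HA) as [F [HF FA]].
  assert (He := proj1 HA); assert (H0 : - eps < 0 < eps) by lra.
  split.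
  + apply (locally_sym_interval _ eps); [exact H0|].
    intros t Ht; eexists; apply (is_derive_energy r k l eps F A t HF FA Ht).
  + eexists; split.
    * simpl.
      apply (is_derive_ext_loc (fun t => 2 * PI ^ 2 / r *
        RInt (fun s => weight k l s * (dcos F t s * (2 * dcos1 F t s))) 0 (PI / 2))).
      -- apply (locally_sym_interval _ eps); [exact H0|].
         intros t Ht; symmetry; apply is_derive_unique, (is_derive_energy r k l eps F A t HF FA Ht).
      -- apply (is_derive_scal (fun t =>
           RInt (fun s => weight k l s * (dcos F t s * (2 * dcos1 F t s))) 0 (PI / 2))).
         apply (is_derive_weighted_dcos1 k l eps); assumption.
    * apply Rmult_le_pos; [exact Hpos|].
      assert (Hreg := fun s => dcos_regular eps F 0 s HF H0).
      assert (I1 : ex_RInt (fun s => weight k l s * (dcos1 F 0 s * (2 * dcos1 F 0 s))) 0 (PI / 2)).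
      { apply (ex_RInt_continuity_2d 
          (fun t s => weight k l s * (dcos1 F t s * (2 * dcos1 F t s)))); [lra|].
        intros s Hs; destruct (Hreg s Hs) as [_ [H1 _]].
        destruct (O_sc_double _ _ _ H1); apply continuity_2d_pt_weight; tauto. }
      assert (I2 : ex_RInt (dcos2 F 0) 0 (PI / 2)).
      { apply ex_RInt_continuity_2d; [lra|]; intros s Hs; apply (Hreg s Hs). }
      (* Constant flux reduces the term with [dcos2] to a multiple of its vanishing integral; what
         remains is a nonnegative weight times a square. *)
      rewrite (RInt_ext _ (fun s => plus (weight k l s * (dcos1 F 0 s * (2 * dcos1 F 0 s)))
                                         (scal (2 * c) (dcos2 F 0 s)))).
      -- rewrite (RInt_plus (fun s => weight k l s * (dcos1 F 0 s * (2 * dcos1 F 0 s)))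
                            (fun s => scal (2 * c) (dcos2 F 0 s)));
           [|exact I1 | apply (ex_RInt_scal (dcos2 F 0)); exact I2].
         rewrite (RInt_scal (dcos2 F 0)), (RInt_dcos2 eps) by assumption.
         unfold plus, scal; simpl; unfold mult; simpl.
         rewrite Rmult_0_r, Rplus_0_r.
         apply RInt_ge_0; [lra | exact I1 |].
         intros s Hs; apply Rmult_le_pos; [|nra].
         apply Rmult_le_pos;
           [nra | apply Rlt_le, Rinv_0_lt_compat, sc_pos, Hs].
      -- rewrite Rmin_left, Rmax_right by lra; intros s Hs.
         rewrite <- (weighted_dcos_0 k l alpha eps A F c HA FA Hc s Hs).
         unfold plus, scal; simpl; unfold mult; simpl; ring.
Qed.

(** * The Euler-Lagrange equation *)

Definition quarter (s : R) : Prop := 0 < s < PI / 2.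

Lemma open_quarter : open quarter.
Proof. exact locally_interior. Qed.

Lemma smooth_on_quarter_interior alpha : smooth_on_quarter alpha -> Cinf quarter alpha.
Proof.
intros H n; apply smooth_on_quarterP in H.
destruct H as [O [F [HO [HU [HF Ff]]]]].
apply (Ck_ext quarter n F); [exact open_quarter | intros s []; apply Ff; lra|].
apply (Ck_subset quarter O); [intros s []; apply HU; lra | apply HF].
Qed.

Lemma Cinf_flux k l alpha : Cinf quarter alpha -> Cinf quarter (flux k l alpha).
Proof.
intros Ha n; unfold flux, weight, sc.
assert (Hs := Ck_sin quarter n); assert (Hc := Ck_cos quarter n).
apply Ck_mult; [apply Ck_div|apply Ck_mult].
- intros s Hs'; apply Rgt_not_eq, (sc_pos s Hs').
- apply Ck_plus; apply Ck_mult;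
    try apply Ck_const; simpl; repeat apply Ck_mult; auto using Ck_const.
- apply Ck_mult; assumption.
- apply Ck_Derive; [exact open_quarter | apply Ha].
- apply (Ck_comp quarter (fun _ => True)); [auto | apply Ha | apply Ck_sin].
Qed.

Lemma Derive_flux k l alpha s : Cinf quarter alpha -> quarter s ->
  Derive (flux k l alpha) s =
  weight k l s * (Derive_n alpha 2 s * sin (alpha s) + Derive alpha s ^ 2 * cos (alpha s))
  + (IZR k ^ 2 / cos s ^ 2 - IZR l ^ 2 / sin s ^ 2) * (Derive alpha s * sin (alpha s)).
Proof.
intros Ha Hs.
assert (H1 := Cinf_is_derive quarter alpha s Ha Hs).
assert (H2 := Cinf_is_derive quarter (Derive alpha) s 
  (Cinf_Derive_n quarter 1 alpha open_quarter Ha) Hs).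
assert (Hsc := sc_pos s Hs); unfold sc in Hsc.
assert (H3 := sin_cos_sqr s).
apply is_derive_unique; unfold flux, weight, sc.
auto_derive.
- repeat split; try (eexists; eassumption); nra.
- change (Derive (fun x => Derive (fun x0 => alpha x0) x) s) with (Derive (Derive alpha) s).
  change (Derive (fun x => alpha x) s) with (Derive alpha s).
  change (Derive (fun x => Derive alpha x) s) with (Derive (Derive alpha) s).
  simpl Derive_n.
  change (Derive (fun x => Derive (fun x0 => alpha x0) x) s) with (Derive (Derive alpha) s).
  set (X := Derive alpha s); set (Y := Derive (Derive alpha) s).
  set (u := sin s) in *; set (v := cos s) in *.
  assert (Hu : u <> 0) by nra; assert (Hv : v <> 0) by nra.
  apply Rminus_diag_uniq.
  (* The two expressions are equal only modulo [sin^2 + cos^2 = 1], so their difference is displayed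
     as a multiple of [u ^ 2 + v ^ 2 - 1]. *)
  transitivity ((IZR k ^ 2 * u ^ 2 - IZR l ^ 2 * v ^ 2) * X * sin (alpha s) *
                (u ^ 2 + v ^ 2 - 1) / (u ^ 2 * v ^ 2)).
  + field; auto.
  + rewrite H3; unfold Rdiv; ring.
Qed.

(** The expression in braces in the equation is the derivative of the flux divided by [sc s], which
    is positive on the open interval. *)
Lemma EL_equation_flux k l alpha : Cinf quarter alpha ->
  EL_equation k l alpha <->
  (forall s, quarter s -> Derive alpha s * sin (alpha s) * Derive (flux k l alpha) s = 0).
Proof.
intros Ha.
assert (E : forall s, quarter s ->
  Derive alpha s * sin (alpha s) * Derive (flux k l alpha) s =
  sc s * (Derive alpha s * sin (alpha s) *
    ((Derive_n alpha 2 s * sin (alpha s) + Derive alpha s ^ 2 * cos (alpha s)) *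
       (IZR k ^ 2 / cos s ^ 2 + IZR l ^ 2 / sin s ^ 2) +
     Derive alpha s * sin (alpha s) *
       (IZR k ^ 2 / (sin s * cos s ^ 3) - IZR l ^ 2 / (cos s * sin s ^ 3))))).
{ intros s Hs; rewrite Derive_flux by assumption.
  assert (Hsc := sc_pos s Hs); unfold sc in Hsc; unfold weight, sc.
  field; split; nra. }
split; intros H s Hs.
- rewrite (E s Hs), (H s Hs); ring.
- assert (Hsc := sc_pos s Hs); specialize (H s Hs); rewrite (E s Hs) in H.
  apply Rmult_integral in H; destruct H as [H|H]; [lra | exact H].
Qed.

Lemma continuous_neq_0_locally (f : R -> R) (s : R) : continuous f s -> f s <> 0 ->
  locally s (fun x : R => f x <> 0).
Proof.
intros Cf Hf.
apply continuity_pt_filterlim in Cf.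
destruct (proj1 (continuity_pt_locally _ _) Cf (mkposreal _ (Rabs_pos_lt _ Hf))) as [d Hd].
exists d; intros x Hx E; specialize (Hd x Hx); simpl in Hd.
rewrite E, Rminus_0_l, Rabs_Ropp in Hd; lra.
Qed.

(* Near a point where the flux has nonzero derivative, the equation forces the
   flux itself to vanish. *)
Lemma EL_equation_flux_const k l alpha : Cinf quarter alpha ->
  EL_equation k l alpha -> exists c, forall s, quarter s -> flux k l alpha s = c.
Proof.
intros Ha HEL; rewrite EL_equation_flux in HEL by exact Ha.
assert (Hf := Cinf_flux k l alpha Ha).
assert (H0 : forall s, quarter s -> Derive (flux k l alpha) s = 0).
{ intros s Hs.
  destruct (Req_dec (Derive (flux k l alpha) s) 0) as [|Hn]; [assumption|].
  assert (C := Cinf_continuous _ _ s (Cinf_Derive_n quarter 1 _ open_quarter Hf) Hs).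
  rewrite (Derive_ext_loc _ (fun _ => 0)); [apply Derive_const|].
  apply (filter_imp (fun x => quarter x /\ Derive (flux k l alpha) x <> 0)).
  - intros x [Hx Hxn]; specialize (HEL x Hx).
    apply Rmult_integral in HEL; destruct HEL as [E|E]; [|contradiction].
    unfold flux; rewrite E; ring.
  - apply filter_and; [exact (open_quarter s Hs) | exact (continuous_neq_0_locally _ _ C Hn)]. }
assert (Hlt : forall x y, quarter x -> quarter y -> x < y ->
          flux k l alpha x = flux k l alpha y).
{ intros x y Hx Hy Hxy; apply eq_is_derive; [|exact Hxy].
  intros z Hz; assert (Hq : quarter z) by (unfold quarter in *; lra).
  change (@zero R_NormedModule) with 0.
  rewrite <- (H0 z Hq); exact (Cinf_is_derive _ _ z Hf Hq). }
exists (flux k l alpha (PI / 4)); intros s Hs.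
assert (H4 : quarter (PI / 4)) by (unfold quarter; generalize PI_RGT_0; lra).
destruct (Rtotal_order s (PI / 4)) as [H|[->|H]]; [auto | reflexivity | symmetry; auto].
Qed.

Lemma flux_const_EL_equation k l alpha c : Cinf quarter alpha ->
  (forall s, quarter s -> flux k l alpha s = c) -> EL_equation k l alpha.
Proof.
intros Ha Hc; apply EL_equation_flux; [exact Ha|]; intros s Hs.
rewrite (Derive_ext_loc (flux k l alpha) (fun _ => c)), Derive_const; [ring|].
exact (filter_imp _ _ Hc (open_quarter s Hs)).
Qed.

(** * Critical points satisfy the equation *)

Lemma EL_equation_ext k l f g :
  (forall s, quarter s -> f s = g s) -> EL_equation k l f -> EL_equation k l g.
Proof.
intros Hfg HEL s Hs.
assert (Hl := filter_imp _ _ Hfg (open_quarter s Hs)).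
rewrite <- (Hfg s Hs), <- (Derive_n_ext_loc f g 2 s Hl), <- (Derive_ext_loc f g s Hl).
exact (HEL s Hs).
Qed.

(** The integrals over [[a, x]] and [[x, b]] are nonnegative with sum 0, so the first is 0 for all
    [x], and its derivative in [x] is [f]. *)
Lemma RInt_eq_0 f a b : a < b ->
  (forall s, a <= s <= b -> continuous f s) -> (forall s, a < s < b -> 0 <= f s) ->
  RInt f a b = 0 -> forall s, a < s < b -> f s = 0.
Proof.
intros Hab Cf Hpos HI s Hs.
assert (Hex : forall x y, a <= x <= b -> a <= y <= b -> x <= y -> ex_RInt f x y).
{ intros x y Hx Hy Hxy; apply (@ex_RInt_continuous R_CompleteNormedModule).
  rewrite Rmin_left, Rmax_right by exact Hxy; intros z Hz; apply Cf; lra. }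
assert (H0 : forall x, a < x < b -> RInt f a x = 0).
{ intros x Hx.
  assert (P1 : 0 <= RInt f a x)
    by (apply RInt_ge_0; [lra | apply Hex; lra | intros; apply Hpos; lra]).
  assert (P2 : 0 <= RInt f x b)
    by (apply RInt_ge_0; [lra | apply Hex; lra | intros; apply Hpos; lra]).
  assert (P3 := RInt_Chasles f a x b 
    (Hex a x ltac:(lra) ltac:(lra) ltac:(lra)) (Hex x b ltac:(lra) ltac:(lra) ltac:(lra))).
  rewrite HI in P3; unfold plus in P3; simpl in P3; lra. }
assert (Hloc : locally s (fun x => a < x < b))
  by exact (open_and _ _ (open_gt a) (open_lt b) s Hs).
rewrite <- (is_derive_unique (RInt f a) s (f s)).
- rewrite (Derive_ext_loc (RInt f a) (fun _ => 0)), Derive_const; [reflexivity|].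
  exact (filter_imp _ _ H0 Hloc).
- apply (is_derive_RInt f (RInt f a) a s); [|apply Cf; lra].
  apply (filter_imp (fun x => a < x < b)); [|exact Hloc].
  intros x Hx; apply (@RInt_correct R_CompleteNormedModule), Hex; lra.
Qed.

(** Functions affine in [u] are closed under both partial derivatives: the pair [(a, b)] becomes
    [(b, 0)] or [(a', b')]. Hence the induction runs over all pairs. *)
Lemma ex_diff_n_affine (O : R -> Prop) a b : open O -> Cinf O a -> Cinf O b ->
  forall n t s, O s -> ex_diff_n (fun u v => a v + u * b v) n t s.
Proof.
intros HO Ha Hb n; revert a b Ha Hb; induction n as [|n IH]; intros a b Ha Hb t s Hs.
- split; [|exact I].
  apply continuity_2d_pt_plus; [|apply continuity_2d_pt_mult; [apply continuity_2d_pt_id1|]];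
    apply continuous_2d_y, (Cinf_continuous O); assumption.
- assert (Da := fun x => Cinf_is_derive O a x Ha); assert (Db := fun x => Cinf_is_derive O b x Hb).
  assert (D1 : forall u v, is_derive (fun z => a v + z * b v) u (b v + u * 0)).
  { intros u v; auto_derive; [exact I | ring]. }
  assert (D2 : forall u v, O v ->
    is_derive (fun z => a z + u * b z) v (Derive a v + u * Derive b v)).
  { intros u v Hv; apply (is_derive_plus a (fun z => u * b z)); [auto|].
    apply (is_derive_scal b); auto. }
  split; [|split; [|split; [|split]]].
  + exact (proj1 (ex_diff_n_m n 0 (Nat.le_0_l n) _ _ _ (IH a b Ha Hb t s Hs))).
  + eexists; apply D1.
  + eexists; apply D2, Hs.
  + apply (ex_diff_n_ext_loc (fun u v => b v + u * 0)).
    * apply locally_2d_forall; intros u v; symmetry; apply is_derive_unique, D1.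
    * apply (IH b (fun _ => 0)); [exact Hb | intros m; apply Ck_const | exact Hs].
  + apply (ex_diff_n_ext_loc (fun u v => Derive a v + u * Derive b v)).
    * destruct (HO s Hs) as [d Hd]; exists d; intros u v _ Hv.
      symmetry; apply is_derive_unique, D2, Hd, ball_R, Hv.
    * apply IH; [apply (Cinf_Derive_n O 1) | apply (Cinf_Derive_n O 1) | exact Hs]; assumption.
Qed.

Lemma critical_EL_equation r k l alpha : 0 < r -> admissible alpha ->
  critical r k l alpha -> EL_equation k l alpha.
Proof.
intros Hr [Hsm [_ [Ha0 Ha1]]] Hcrit; assert (HP := PI_RGT_0).
apply smooth_on_quarterP in Hsm; destruct Hsm as [O [F [HO [HU [HF Ff]]]]].
assert (HUq : forall s, quarter s -> O s) by (intros s []; apply HU; lra).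
assert (HFq : Cinf quarter F) by (intros n; apply (Ck_subset quarter O); auto).
set (g := fun s => Derive F s * sin (F s)).
assert (HsF : Cinf O (fun s => sin (F s)))
  by (intros n; apply (Ck_comp O (fun _ => True)); auto using Ck_sin).
assert (Hsq : forall f, Cinf O f -> forall n, Ck O n (fun s => f s ^ 2))
  by (intros f Hf n; simpl; repeat apply Ck_mult; auto using Ck_const).
assert (Hg : Cinf O g).
{ intros n; apply Ck_mult; [apply (Cinf_Derive_n O 1) | apply HsF]; assumption. }
assert (Hg' : Cinf O (Derive g)) by (apply (Cinf_Derive_n O 1); assumption).
assert (Hsin : Cinf O sin) by (intros n; apply Ck_sin).
assert (Hcos : Cinf O cos) by (intros n; apply Ck_cos).
assert (Hsc : Cinf O sc) by (intros n; apply Ck_mult; auto).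
set (K := fun s => IZR k ^ 2 * sin s ^ 2 + IZR l ^ 2 * cos s ^ 2).
assert (HK : Cinf O K).
{ intros n; apply Ck_plus; apply Ck_mult; auto using Ck_const. }
(* [N] is the derivative of the flux multiplied by [sc ^ 2], which removes its poles. *)
set (N := fun s => (IZR k ^ 2 * sin s ^ 2 - IZR l ^ 2 * cos s ^ 2) * g s + K s * sc s * Derive g s).
assert (HN : Cinf O N).
{ intros n; apply Ck_plus; apply Ck_mult; auto.
  - apply Ck_minus; apply Ck_mult; auto using Ck_const.
  - apply Ck_mult; auto. }
(* The second factor [sc ^ 2], beyond the one inside [N], is chosen so that the flux derivative
   times [beta * sin F] is the perfect square [(N * sin F) ^ 2]. *)
set (beta := fun s => N s * sin (F s) * sc s ^ 2).
assert (Hbeta : Cinf O beta).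
{ intros n; apply Ck_mult; [apply Ck_mult; auto | auto]. }
(* Minus the [t]-derivative of [cos (A t s)] at 0, whence [dcos1 A 0] is the derivative of [eta]. *)
set (eta := fun s => beta s * sin (F s)).
assert (Heta : Cinf O eta) by (intros n; apply Ck_mult; auto).
set (A := fun t s => F s + t * beta s).
assert (Hbd : forall t, A t 0 = 0 /\ A t (PI / 2) = PI).
{ intros t; unfold A, beta, sc; rewrite sin_0, cos_PI2, !Ff, Ha0, Ha1 by lra.
  split; ring. }
assert (Hfe : fixed_ends 1 A).
{ split; [lra|]; split; [|intros; apply Hbd].
  intros t s _ Hs; destruct (HO s (HU s Hs)) as [d Hd]; exists d; intros u v _ Hv n.
  apply (ex_diff_n_affine O); auto; apply Hd, ball_R, Hv. }
assert (Hvar : variation alpha 1 A).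
{ split; [lra|]; split; [|split].
  - exists A; split; [apply Hfe | reflexivity].
  - intros s Hs; unfold A; rewrite Ff by exact Hs; ring.
  - intros; apply Hbd. }
assert (HI : RInt (fun s => weight k l s * (dcos A 0 s * (2 * dcos1 A 0 s))) 0 (PI / 2) = 0).
{ assert (E := is_derive_energy r k l 1 A A 0 Hfe ltac:(reflexivity) ltac:(lra)).
  apply is_derive_unique in E; rewrite (is_derive_unique _ _ _ (Hcrit 1 A Hvar)) in E.
  symmetry in E; apply Rmult_integral in E; destruct E as [E|E]; [|exact E].
  exfalso; revert E; apply Rgt_not_eq, Rdiv_lt_0_compat; [nra | exact Hr]. }
assert (Ed2 : forall u s, O s -> pds A u s = Derive F s + u * Derive beta s).
{ intros u s Hs; apply is_derive_unique.
  apply (is_derive_plus F (fun z => u * beta z)); [apply (Cinf_is_derive O); assumption|].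
  apply (is_derive_scal beta); apply (Cinf_is_derive O); assumption. }
assert (Edcos : forall s, O s -> dcos A 0 s = g s).
{ intros s Hs; unfold dcos, g; rewrite Ed2 by exact Hs; unfold A.
  rewrite !Rmult_0_l, !Rplus_0_r; reflexivity. }
assert (Edcos1 : forall s, O s -> dcos1 A 0 s = Derive eta s).
{ intros s Hs; unfold dcos1.
  replace (pdt A 0 s) with (beta s)
    by (symmetry; apply is_derive_unique; unfold A; auto_derive; [exact I | ring]).
  replace (pdt (pds A) 0 s) with (Derive beta s).
  - rewrite Ed2 by exact Hs; unfold A; rewrite !Rmult_0_l, !Rplus_0_r.
    symmetry; apply is_derive_unique; evar_last.
    + apply (is_derive_mult beta (fun s => sin (F s)));
        [apply (Cinf_is_derive O); assumption | | intros; apply Rmult_comm].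
      apply (is_derive_comp sin F); [apply is_derive_sin | apply (Cinf_is_derive O); assumption].
    + unfold plus, mult, scal; simpl; unfold mult; simpl; ring.
  - unfold pdt; rewrite (Derive_ext (fun z => pds A z s) (fun z => Derive F s + z * Derive beta s)).
    + symmetry; apply is_derive_unique; auto_derive; [exact I | ring].
    + intros z; apply Ed2, Hs. }
(* The product of the flux and [eta] with the pole cancelled. It is smooth up to the endpoints and
   vanishes there with [sc], so integrating by parts leaves no boundary term. *)
set (Phi := fun s => K s * sc s * g s * N s * sin (F s) ^ 2).
assert (HPhi : Cinf O Phi).
{ intros n; apply Ck_mult; [|apply (Hsq (fun s => sin (F s))); exact HsF].
  apply Ck_mult; [apply Ck_mult; [apply Ck_mult|]|]; auto. }
assert (EK : forall s, quarter s -> Derive (flux k l F) s * sc s ^ 2 = N s).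
{ intros s Hs; rewrite Derive_flux by assumption.
  replace (Derive_n F 2 s * sin (F s) + Derive F s ^ 2 * cos (F s)) with (Derive g s).
  - assert (Hp := sc_pos s Hs); unfold sc in Hp; unfold N, K, weight, g, sc; field; split; nra.
  - apply is_derive_unique; evar_last.
    + apply (is_derive_mult (Derive F) (fun s => sin (F s)));
        [apply (Cinf_is_derive O); [apply (Cinf_Derive_n O 1) |]; auto | |
         intros; apply Rmult_comm].
      apply (is_derive_comp sin F); [apply is_derive_sin | apply (Cinf_is_derive O); auto].
    + change (Derive_n F 2 s) with (Derive (Derive F) s).
      unfold plus, mult, scal; simpl; unfold mult; simpl; ring. }
assert (EPhi : forall s, quarter s ->
  Derive Phi s = (N s * sin (F s)) ^ 2 + weight k l s * (g s * Derive eta s)).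
{ intros s Hs; rewrite (Derive_ext_loc Phi (fun x => flux k l F x * eta x)).
  - rewrite Derive_mult.
    + assert (Hp := sc_pos s Hs); rewrite <- (EK s Hs) at 1.
      unfold eta at 1, beta; rewrite <- (EK s Hs).
      unfold flux, g; ring.
    + eexists; apply (Cinf_is_derive quarter); [apply Cinf_flux|]; assumption.
    + eexists; apply (Cinf_is_derive O); auto.
  - apply (filter_imp quarter); [|exact (open_quarter s Hs)].
    intros x Hx; assert (Hp := sc_pos x Hx).
    unfold Phi, flux, weight, eta, beta; fold (K x); fold (g x).
    simpl; field; lra. }
assert (CN : forall s, 0 <= s <= PI / 2 -> continuous (fun s => (N s * sin (F s)) ^ 2) s).
{ intros s Hs; apply (Cinf_continuous O); [|auto].
  intros n; apply (Hsq (fun s => N s * sin (F s))); intros m; apply Ck_mult; auto. }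
assert (IPhi : is_RInt (Derive Phi) 0 (PI / 2) 0).
{ evar_last.
  - apply (is_RInt_derive Phi); rewrite Rmin_left, Rmax_right by lra; intros s Hs.
    + apply (Cinf_is_derive O); auto.
    + apply (Cinf_continuous O); [apply (Cinf_Derive_n O 1)|]; auto.
  - unfold Phi, sc; rewrite sin_0, cos_PI2; unfold minus, plus, opp; simpl; ring. }
(* Of the two summands of [Derive Phi] in [EPhi], whose total integral is 0, the second is half the
   integrand in [HI] and integrates to 0 by criticality. *)
assert (IN : RInt (fun s => (N s * sin (F s)) ^ 2) 0 (PI / 2) = 0).
{ assert (HNI : ex_RInt (fun s => (N s * sin (F s)) ^ 2) 0 (PI / 2)).
  { apply (@ex_RInt_continuous R_CompleteNormedModule).
    rewrite Rmin_left, Rmax_right by lra; exact CN. }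
  apply (@RInt_correct R_CompleteNormedModule) in HNI.
  assert (H := is_RInt_scal _ _ _ 2 _ (is_RInt_minus _ _ _ _ _ _ IPhi HNI)).
  apply (is_RInt_ext _ (fun s => weight k l s * (dcos A 0 s * (2 * dcos1 A 0 s)))) in H.
  - apply (@is_RInt_unique R_CompleteNormedModule) in H; rewrite HI in H.
    change (0 = 2 * (0 + - RInt (fun s => (N s * sin (F s)) ^ 2) 0 (PI / 2))) in H; lra.
  - rewrite Rmin_left, Rmax_right by lra; intros s Hs.
    rewrite Edcos, Edcos1, EPhi by auto.
    unfold scal, minus, plus, opp; simpl; unfold mult; simpl; ring. }
apply (EL_equation_ext k l F); [intros s []; apply Ff; lra|].
apply EL_equation_flux; [exact HFq|]; intros s Hs.
assert (H0 := RInt_eq_0 _ 0 (PI / 2) ltac:(lra) CN ltac:(intros; apply pow2_ge_0) IN s Hs).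
cbv beta in H0; rewrite <- (EK s Hs) in H0; assert (Hp := sc_pos s Hs).
assert (H1 : Derive (flux k l F) s * sc s ^ 2 * sin (F s) = 0) by nra.
apply (Rmult_eq_reg_r (sc s ^ 2)); [|nra].
transitivity (Derive F s * (Derive (flux k l F) s * sc s ^ 2 * sin (F s)));
  [ring | rewrite H1; ring].
Qed.

(** * The explicit solutions *)

(* [log_quot 0 z] is [ln (1 + z) / z], extended smoothly across [z = 0]; the
   other members of the family are its derivatives up to a constant. *)
Definition log_quot (m : nat) (z : R) : R :=
  RInt (fun x => x ^ m / (1 + x * z) ^ S m) 0 1.

Lemma one_plus_pos x z : -1 < z -> 0 <= x <= 1 -> 0 < 1 + x * z.
Proof. intros Hz Hx; destruct (Rle_dec 0 z); nra. Qed.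

Lemma continuity_2d_pt_pow p n t s : continuity_2d_pt p t s ->
  continuity_2d_pt (fun u v => p u v ^ n) t s.
Proof.
intros H; apply (continuity_1d_2d_pt_comp (fun x => x ^ n)); [|exact H].
apply derivable_continuous_pt, derivable_pt_pow.
Qed.

Lemma continuity_2d_pt_log_quot m z x : -1 < z -> 0 <= x <= 1 ->
  continuity_2d_pt (fun u v => v ^ m / (1 + v * u) ^ S m) z x.
Proof.
intros Hz Hx.
apply continuity_2d_pt_mult; [apply continuity_2d_pt_pow, continuity_2d_pt_id2|].
apply continuity_2d_pt_inv.
- apply continuity_2d_pt_pow, continuity_2d_pt_plus; [apply continuity_2d_pt_const|].
  apply continuity_2d_pt_mult; [apply continuity_2d_pt_id2 | apply continuity_2d_pt_id1].
- apply pow_nonzero, Rgt_not_eq, one_plus_pos; assumption.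
Qed.

Lemma ex_RInt_log_quot m z : -1 < z -> ex_RInt (fun x => x ^ m / (1 + x * z) ^ S m) 0 1.
Proof.
intros Hz; apply (ex_RInt_continuity_2d (fun u v => v ^ m / (1 + v * u) ^ S m)); [lra|].
intros s Hs; apply continuity_2d_pt_log_quot; assumption.
Qed.

Lemma is_derive_log_quot m z : -1 < z ->
  is_derive (log_quot m) z (- INR (S m) * log_quot (S m) z).
Proof.
intros Hz.
evar_last.
- apply (is_derive_RInt_param_open (fun z => -1 < z)
    (fun u v => v ^ m / (1 + v * u) ^ S m)
    (fun u v => - INR (S m) * (v ^ S m / (1 + v * u) ^ S (S m)))).
  + apply open_gt.
  + lra.
  + intros; apply continuity_2d_pt_log_quot; assumption.
  + intros; apply continuity_2d_pt_mult;
      [apply continuity_2d_pt_const | apply continuity_2d_pt_log_quot; assumption].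
  + intros t s Ht Hs.
    destruct (continuity_2d_pt_neq_0 (fun u v => 1 + v * u) t s) as [d Hd].
    * apply continuity_2d_pt_plus; [apply continuity_2d_pt_const|].
      apply continuity_2d_pt_mult; [apply continuity_2d_pt_id2 | apply continuity_2d_pt_id1].
    * apply Rgt_not_eq, one_plus_pos; assumption.
    * exists d; intros u v Hu Hv; specialize (Hd u v Hu Hv); cbv beta in Hd.
      evar_last.
      -- apply (is_derive_scal (fun z => / (1 + v * z) ^ S m)).
         apply (is_derive_inv (fun z => (1 + v * z) ^ S m));
           [|apply pow_nonzero; exact Hd].
         apply (is_derive_pow (fun z => 1 + v * z) (S m) u v).
         auto_derive; [exact I | ring].
      -- rewrite Nat.pred_succ.
         change (v ^ S m) with (v * v ^ m).
         change ((1 + v * u) ^ S (S m)) with ((1 + v * u) * ((1 + v * u) * (1 + v * u) ^ m)).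
         change ((1 + v * u) ^ S m) with ((1 + v * u) * (1 + v * u) ^ m).
         field; split; [apply pow_nonzero|]; exact Hd.
  + exact Hz.
- exact (RInt_scal _ 0 1 (- INR (S m)) (ex_RInt_log_quot (S m) z Hz)).
Qed.

Lemma Ck_log_quot n m : Ck (fun z => -1 < z) n (log_quot m).
Proof.
revert m; induction n as [|n IH]; intros m; [exact I|].
exists (fun z => - INR (S m) * log_quot (S m) z); split.
- intros z Hz; apply is_derive_log_quot, Hz.
- apply Ck_mult; [apply Ck_const | apply IH].
Qed.

Lemma log_quot_pos z : -1 < z -> 0 < log_quot 0 z.
Proof.
intros Hz; apply RInt_gt_0; [lra | |].
- intros x Hx; simpl; rewrite Rmult_1_r.
  apply Rdiv_lt_0_compat; [lra | apply one_plus_pos; lra].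
- intros x Hx.
  apply (continuity_2d_pt_continuous_y (fun u v => v ^ 0 / (1 + v * u) ^ 1)).
  apply continuity_2d_pt_log_quot; assumption.
Qed.

(** As a function of [x], [z / (1 + x z)] has primitive [ln (1 + x z)]. The product form covers
    [z = 0]. *)
Lemma log_quot_ln z : -1 < z -> z * log_quot 0 z = ln (1 + z).
Proof.
intros Hz.
transitivity (RInt (fun x => scal z (x ^ 0 / (1 + x * z) ^ 1)) 0 1).
- symmetry; exact (RInt_scal _ 0 1 z (ex_RInt_log_quot 0 z Hz)).
- apply is_RInt_unique; evar_last.
  + apply (is_RInt_derive (fun x => ln (1 + x * z))); rewrite Rmin_left, Rmax_right by lra;
      intros x Hx; assert (Hp := one_plus_pos x z Hz Hx).
    * auto_derive; [exact Hp|]; unfold scal; simpl; unfold mult; simpl; field; lra.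
    * apply (ex_derive_continuous (fun x => scal z (x ^ 0 / (1 + x * z) ^ 1))).
      unfold scal; simpl; unfold mult; simpl.
      auto_derive; lra.
  + rewrite Rmult_0_l, Rplus_0_r, ln_1, Rmult_1_l.
    unfold minus, plus, opp; simpl; ring.
Qed.

(* [sin (alpha / 2)] and [cos (alpha / 2)] for the solution [alpha], with
   [q = k ^ 2 / l ^ 2]; unlike the arccosine these are visibly smooth at the endpoints. *)
Definition half_sin (q s : R) : R :=
  sin s * sqrt ((q - 1) / ln q * log_quot 0 ((q - 1) * sin s ^ 2)).
Definition half_cos (q s : R) : R :=
  cos s * sqrt ((1 - / q) / ln q * log_quot 0 (- (1 - / q) * cos s ^ 2)).

Lemma half_args q s : 1 < q ->
  0 < ln q /\ 0 < / q < 1 /\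
  -1 < (q - 1) * sin s ^ 2 /\ -1 < - (1 - / q) * cos s ^ 2 /\
  0 < (q - 1) / ln q * log_quot 0 ((q - 1) * sin s ^ 2) /\
  0 < (1 - / q) / ln q * log_quot 0 (- (1 - / q) * cos s ^ 2).
Proof.
intros Hq.
assert (HL : 0 < ln q) by (rewrite <- ln_1; apply ln_increasing; lra).
assert (Hi : 0 < / q < 1).
{ split; [apply Rinv_0_lt_compat; lra|].
  rewrite <- Rinv_1; apply Rinv_lt_contravar; lra. }
assert (H3 := sin_cos_sqr s).
assert (A1 := pow2_ge_0 (sin s)); assert (A2 := pow2_ge_0 (cos s)).
assert (B1 : -1 < (q - 1) * sin s ^ 2) by nra.
assert (B2 : -1 < - (1 - / q) * cos s ^ 2) by nra.
repeat split; try tauto;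
  (apply Rmult_lt_0_compat; [apply Rdiv_lt_0_compat; lra | apply log_quot_pos; assumption]).
Qed.

(** * Smoothness and flux of the arccosine solution *)

Definition log_ratio (q s : R) : R := ln (q * sin s ^ 2 + cos s ^ 2) / ln q.

Lemma half_sin_sqr q s : 1 < q -> half_sin q s ^ 2 = log_ratio q s.
Proof.
intros Hq; destruct (half_args q s Hq) as [HL [Hi [H1 [H2 [H3 H4]]]]].
unfold half_sin, log_ratio; rewrite Rpow_mult_distr, pow2_sqrt by lra.
replace (q * sin s ^ 2 + cos s ^ 2) with (1 + (q - 1) * sin s ^ 2).
- rewrite <- log_quot_ln by exact H1; field; lra.
- rewrite <- !Rsqr_pow2, cos2; ring.
Qed.

(** The argument of the logarithm is expanded about [s = PI / 2] as [q (1 - (1 - 1/q) cos^2 s)]; the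
    factor [q] accounts for the 1. In [half_sin_sqr] the expansion is about [s = 0]. *)
Lemma half_cos_sqr q s : 1 < q -> half_cos q s ^ 2 = 1 - log_ratio q s.
Proof.
intros Hq; destruct (half_args q s Hq) as [HL [Hi [H1 [H2 [H3 H4]]]]].
unfold half_cos, log_ratio; rewrite Rpow_mult_distr, pow2_sqrt by lra.
replace (q * sin s ^ 2 + cos s ^ 2) with (q * (1 + - (1 - / q) * cos s ^ 2)).
- rewrite ln_mult, <- log_quot_ln by lra; field; lra.
- rewrite <- !Rsqr_pow2, sin2; field; lra.
Qed.

Lemma Cinf_half_sin q : 1 < q -> Cinf (fun _ => True) (half_sin q).
Proof.
intros Hq n; apply Ck_mult; [apply Ck_sin|].
apply (Ck_comp _ (fun x => 0 < x)); [intros s _; apply half_args, Hq | | apply Ck_sqrt].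
apply Ck_mult; [apply Ck_const|].
apply (Ck_comp _ (fun z => -1 < z)); [intros s _; apply half_args, Hq | | apply Ck_log_quot].
simpl; repeat apply Ck_mult; auto using Ck_const, Ck_sin.
Qed.

Lemma Cinf_half_cos q : 1 < q -> Cinf (fun _ => True) (half_cos q).
Proof.
intros Hq n; apply Ck_mult; [apply Ck_cos|].
apply (Ck_comp _ (fun x => 0 < x)); [intros s _; apply half_args, Hq | | apply Ck_sqrt].
apply Ck_mult; [apply Ck_const|].
apply (Ck_comp _ (fun z => -1 < z)); [intros s _; apply half_args, Hq | | apply Ck_log_quot].
simpl; repeat apply Ck_mult; auto using Ck_const, Ck_cos.
Qed.

Lemma half_nonneg q s : 1 < q -> 0 <= s <= PI / 2 ->
  0 <= half_sin q s /\ 0 <= half_cos q s /\ 0 < half_sin q s + half_cos q s.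
Proof.
intros Hq Hs.
assert (Ha : 0 <= half_sin q s)
  by (apply Rmult_le_pos; [apply sin_ge_0; lra | apply sqrt_pos]).
assert (Hb : 0 <= half_cos q s)
  by (apply Rmult_le_pos; [apply cos_ge_0; lra | apply sqrt_pos]).
assert (E1 := half_sin_sqr q s Hq); assert (E2 := half_cos_sqr q s Hq).
repeat split; [exact Ha | exact Hb | nra].
Qed.

(** If [a = sin (x / 2)] and [b = cos (x / 2)], then [(a - b) / (a + b)] is the tangent of
    [x / 2 - PI / 4], so this recovers [x] from its half-angle sine and cosine. *)
Lemma cos_double_atan a b : 0 < a + b -> a ^ 2 + b ^ 2 = 1 ->
  cos (PI / 2 + 2 * atan ((a - b) / (a + b))) = b ^ 2 - a ^ 2.
Proof.
intros Hp H1.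
set (y := (a - b) / (a + b)).
assert (E : cos (PI / 2 + 2 * atan y) = - sin (2 * atan y))
  by (rewrite (sin_cos (2 * atan y)); ring).
assert (Hy : 0 < 1 + y²) by (generalize (Rle_0_sqr y); lra).
assert (Hsq : sqrt (1 + y²) * sqrt (1 + y²) = 1 + y²) by (apply sqrt_sqrt; lra).
assert (Hpos := sqrt_lt_R0 _ Hy).
rewrite E, sin_2a, sin_atan, cos_atan.
replace (2 * (y / sqrt (1 + y²)) * (1 / sqrt (1 + y²)))
  with (2 * y / (sqrt (1 + y²) * sqrt (1 + y²))) by (field; lra).
rewrite Hsq.
transitivity ((b ^ 2 - a ^ 2) / (a ^ 2 + b ^ 2)).
- unfold y, Rsqr; field; split; [|split]; nra.
- rewrite H1; field.
Qed.

Lemma atan_le x y : x <= y -> atan x <= atan y.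
Proof. intros [H| ->]; [left; apply atan_increasing, H | right; reflexivity]. Qed.

(** The arccosine is singular at 1 and -1, the values reached at the endpoints. The arctangent
    formula is smooth wherever [d] is positive, an open set containing the closed interval. *)
Lemma smooth_on_quarter_acos_log_ratio q : 1 < q ->
  smooth_on_quarter (fun s => acos (1 - 2 * log_ratio q s)).
Proof.
intros Hq; apply smooth_on_quarterP.
set (d := fun s => half_sin q s + half_cos q s).
assert (Hd : Cinf (fun _ => True) d)
  by (intros n; apply Ck_plus; [apply Cinf_half_sin | apply Cinf_half_cos]; exact Hq).
exists (fun s => 0 < d s),
  (fun s => PI / 2 + 2 * atan ((half_sin q s - half_cos q s) / d s)).
split; [|split; [|split]].
- apply (open_comp d (fun x => 0 < x)); [|apply open_gt].
  intros s _; apply (Cinf_continuous (fun _ => True)); [exact Hd | exact I].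
- intros s Hs; apply half_nonneg; assumption.
- intros n; apply Ck_plus; [apply Ck_const|]; apply Ck_mult; [apply Ck_const|].
  apply (Ck_comp _ (fun _ => True)); [auto | | apply Ck_atan].
  apply Ck_div; [intros s Hs; lra | |].
  + apply Ck_minus; apply (Ck_subset _ (fun _ => True)); auto;
      [apply Cinf_half_sin | apply Cinf_half_cos]; exact Hq.
  + apply (Ck_subset _ (fun _ => True)); auto.
- intros s Hs; destruct (half_nonneg q s Hq Hs) as [Ha [Hb Hp]].
  assert (E1 := half_sin_sqr q s Hq); assert (E2 := half_cos_sqr q s Hq).
  replace (1 - 2 * log_ratio q s) with (half_cos q s ^ 2 - half_sin q s ^ 2) by lra.
  rewrite <- cos_double_atan by lra.
  symmetry; apply acos_cos; unfold d.
  set (y := (half_sin q s - half_cos q s) / (half_sin q s + half_cos q s)).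
  (* This places the arctangent angle in [[0, PI]], where [acos] inverts [cos]. *)
  assert (Hy : -1 <= y <= 1).
  { unfold y; split; apply Rmult_le_reg_r with (half_sin q s + half_cos q s); try lra;
      unfold Rdiv; rewrite Rmult_assoc, Rinv_l by lra; lra. }
  assert (Hat : - (PI / 4) <= atan y <= PI / 4).
  { rewrite <- atan_1, <- atan_opp.
    split; apply atan_le; lra. }
  lra.
Qed.

Lemma log_ratio_bounds q s : 1 < q -> 0 <= log_ratio q s <= 1.
Proof.
intros Hq; generalize (half_sin_sqr q s Hq), (half_cos_sqr q s Hq).
generalize (pow2_ge_0 (half_sin q s)), (pow2_ge_0 (half_cos q s)); lra.
Qed.

Lemma admissible_acos_log_ratio q : 1 < q ->
  admissible (fun s => acos (1 - 2 * log_ratio q s)).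
Proof.
intros Hq; split; [exact (smooth_on_quarter_acos_log_ratio q Hq)|].
split; [intros; apply acos_bound|].
assert (HL := proj1 (half_args q 0 Hq)).
unfold log_ratio; rewrite sin_0, cos_0, sin_PI2, cos_PI2; split.
- replace (q * 0 ^ 2 + 1 ^ 2) with 1 by ring; rewrite ln_1.
  replace (1 - 2 * (0 / ln q)) with 1 by (field; lra); apply acos_1.
- replace (q * 1 ^ 2 + 0 ^ 2) with q by ring.
  replace (1 - 2 * (ln q / ln q)) with (- (1)) by (field; lra).
  rewrite acos_opp, acos_1; ring.
Qed.

(** Differentiating the logarithm puts [q sin^2 + cos^2] in the denominator, and the numerator of
    the weight is [l^2] times the same expression. *)
Lemma flux_acos_log_ratio k l s : l <> 0%Z -> 1 < IZR k ^ 2 / IZR l ^ 2 -> quarter s ->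
  flux k l (fun s => acos (1 - 2 * log_ratio (IZR k ^ 2 / IZR l ^ 2) s)) s =
  4 * (IZR k ^ 2 - IZR l ^ 2) / ln (IZR k ^ 2 / IZR l ^ 2).
Proof.
intros Hl; set (q := IZR k ^ 2 / IZR l ^ 2); intros Hq Hs.
set (alpha := fun s => acos (1 - 2 * log_ratio q s)).
assert (HL := proj1 (half_args q s Hq)).
assert (H3 := sin_cos_sqr s).
assert (Hv : 0 < q * sin s ^ 2 + cos s ^ 2)
  by (generalize (pow2_ge_0 (sin s)); nra).
assert (Hcos : forall x, cos (alpha x) = 1 - 2 * log_ratio q x).
{ intros x; apply cos_acos; generalize (log_ratio_bounds q x Hq); lra. }
assert (E : Derive alpha s * sin (alpha s) =
            4 * (q - 1) * sc s / ((q * sin s ^ 2 + cos s ^ 2) * ln q)).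
{ assert (Ha := smooth_on_quarter_interior _ (smooth_on_quarter_acos_log_ratio q Hq)).
  (* Comparing two derivatives of [cos alpha] yields [alpha' sin alpha] without differentiating
     [acos]. *)
  assert (D1 : is_derive (fun x => cos (alpha x)) s (Derive alpha s * - sin (alpha s))).
  { apply (is_derive_comp cos alpha); [apply is_derive_cos|].
    apply (Cinf_is_derive quarter); assumption. }
  assert (D2 : is_derive (fun x => 1 - 2 * log_ratio q x) s
     (- (4 * (q - 1) * sc s / ((q * sin s ^ 2 + cos s ^ 2) * ln q)))).
  { unfold log_ratio, sc; auto_derive; [simpl in Hv; lra | simpl; field].
    simpl in Hv; lra. }
  apply (is_derive_ext _ _ _ _ Hcos) in D1.
  assert (U := eq_trans (eq_sym (is_derive_unique _ _ _ D1)) (is_derive_unique _ _ _ D2)).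
  lra. }
unfold flux; fold alpha; rewrite E.
assert (Hsc := sc_pos s Hs).
assert (Hl' : IZR l <> 0) by (apply not_0_IZR; exact Hl).
unfold weight.
replace (IZR k ^ 2) with (q * IZR l ^ 2) by (unfold q; field; exact Hl').
field; lra.
Qed.

(** With equal squares the weight is [k^2 / sc], while [2 sin (2 s)] is [4 sc]. *)
Lemma flux_double k l s : IZR k ^ 2 = IZR l ^ 2 -> quarter s ->
  flux k l (fun s => 2 * s) s = 4 * IZR k ^ 2.
Proof.
intros Hkl Hs; unfold flux, weight; rewrite <- Hkl.
replace (Derive (fun s => 2 * s) s) with 2
  by (symmetry; apply is_derive_unique; auto_derive; [exact I | ring]).
assert (Hsc := sc_pos s Hs).
assert (H3 := sin_cos_sqr s).
transitivity (4 * IZR k ^ 2 * (sin s ^ 2 + cos s ^ 2)); [|rewrite H3; ring].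
rewrite sin_2a; unfold sc in *; field; split; nra.
Qed.

Lemma admissible_double : admissible (fun s => 2 * s).
Proof.
assert (HP := PI_RGT_0); split; [|split; [intros; lra | split; lra]].
apply smooth_on_quarterP; exists (fun _ => True), (fun s => 2 * s).
split; [exact open_true | split; [auto | split; [|reflexivity]]].
intros n; apply Ck_mult; [apply Ck_const | apply Ck_id].
Qed.

(** * From constant flux to the equivalence and the stability of the solutions *)

Lemma flux_const_EL_stable r k l alpha c : 0 < r -> admissible alpha ->
  (forall s, quarter s -> flux k l alpha s = c) ->
  admissible alpha /\ EL_equation k l alpha /\ stable_critical r k l alpha.
Proof.
intros Hr Ha Hc; split; [exact Ha|]; split.
- apply (flux_const_EL_equation k l alpha c); [|exact Hc].
  apply smooth_on_quarter_interior, Ha.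
- exact (flux_const_stable r k l alpha c Hr Hc).
Qed.

Theorem proposition3p1 (r : R) (k l : Z)
  (hr : 0 < r) (hk : k <> 0%Z) (hl : l <> 0%Z) :
  (forall alpha : R -> R, admissible alpha ->
     (EL_equation k l alpha <-> critical r k l alpha)) /\
  ((Z.abs l < Z.abs k)%Z ->
     admissible (alpha_log k l) /\
     EL_equation k l (alpha_log k l) /\
     stable_critical r k l (alpha_log k l)) /\
  (Z.abs k = Z.abs l ->
     admissible (fun s => 2 * s) /\
     EL_equation k l (fun s => 2 * s) /\
     stable_critical r k l (fun s => 2 * s)).
Proof.
split; [|split].
- intros alpha Ha; split; [|apply critical_EL_equation; assumption].
  intros HEL; apply EL_equation_flux_const in HEL;
    [|apply smooth_on_quarter_interior, Ha].
  destruct HEL as [c Hc]; exact (proj1 (flux_const_stable r k l alpha c hr Hc)).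
- intros Hkl.
  assert (Hl : 0 < IZR l ^ 2) by (apply pow2_gt_0, not_0_IZR, hl).
  assert (Hq : 1 < IZR k ^ 2 / IZR l ^ 2).
  { apply Rmult_lt_reg_r with (IZR l ^ 2); [exact Hl|].
    replace (IZR k ^ 2 / IZR l ^ 2 * IZR l ^ 2) with (IZR k ^ 2)
      by (field; apply not_0_IZR, hl).
    rewrite Rmult_1_l; simpl; rewrite !Rmult_1_r, <- !mult_IZR; apply IZR_lt.
    rewrite <- (Z.abs_square k), <- (Z.abs_square l).
    apply Z.square_lt_mono_nonneg; [apply Z.abs_nonneg | exact Hkl]. }
  apply (flux_const_EL_stable r k l (alpha_log k l)
    (4 * (IZR k ^ 2 - IZR l ^ 2) / ln (IZR k ^ 2 / IZR l ^ 2)) hr).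
  + exact (admissible_acos_log_ratio _ Hq).
  + intros s Hs; exact (flux_acos_log_ratio k l s hl Hq Hs).
- intros Hkl; apply (flux_const_EL_stable r k l _ (4 * IZR k ^ 2) hr admissible_double).
  intros s Hs; apply flux_double; [|exact Hs].
  simpl; rewrite !Rmult_1_r, <- !mult_IZR, <- (Z.abs_square k), Hkl, Z.abs_square; reflexivity.
Qed.
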